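(* Let $0<\alpha,\gamma<1$, $\beta\ge\alpha$ and $\delta\ge\gamma$. Then $$\psi_{\alpha\gamma,\;\beta-\alpha+\alpha(\delta-\gamma)}(t,s)=\int_0^\infty \psi_{\alpha,\beta-\alpha}(t,r)\,\psi_{\gamma,\delta-\gamma}(r,s)\,dr,\qquad t,s>0.$$
   Context: Wright function: for $\lambda>-1$, $\mu\in\mathbb{C}$, $W_{\lambda,\mu}(z):=\sum_{n=0}^\infty \frac{z^n}{n!\,\Gamma(\lambda n+\mu)}$, $z\in\mathbb{C}$ (with $1/\Gamma=0$ at the poles of $\Gamma$). Scaled Wright function: for $0<\alpha<1$, $\beta\ge0$, $\psi_{\alpha,\beta}(t,s):=t^{\beta-1}W_{-\alpha,\beta}(-st^{-\alpha})$, $t>0$, $s\in\mathbb{C}$. *)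

(* Defs.v *)
From HB Require Import structures.
From mathcomp Require Import all_boot all_order all_algebra.
From mathcomp Require Import all_classical all_reals all_analysis.

Set Implicit Arguments.
Unset Strict Implicit.
Unset Printing Implicit Defensive.

Import Order.TTheory GRing.Theory Num.Theory.
Import numFieldNormedType.Exports.
Local Open Scope classical_set_scope.
Local Open Scope ring_scope.

(* Second-kind Euler integral; meaningful for 0 < x. *)
Definition euler_integral (R : realType) (x : R) : R :=
  \int[@lebesgue_measure R]_(u in `]0, +oo[) (u `^ (x - 1) * expR (- u)).

(* Gamma(x) = Gamma(x + n) / (x (x + 1) ... (x + n - 1)), where
   n = truncn (1 - x) is the least natural number such that 0 < x + n; in
   particular n = 0 and Gamma is the Euler integral when 0 < x. At the poles
   0, -1, -2, ... the product vanishes, so that Gamma x = 0 by convention. *)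
Definition Gamma (R : realType) (x : R) : R :=
  let n := Num.truncn (1 - x) in
  euler_integral (x + n%:R) / \prod_(k < n) (x + k%:R).

(* 1 / Gamma, extended by 0 at the poles: see rGamma_pole. *)
Definition rGamma (R : realType) (x : R) : R := (Gamma x)^-1.

Lemma Gamma_gt0E (R : realType) (x : R) : 0 < x -> Gamma x = euler_integral x.
Proof.
move=> x0; rewrite /Gamma.
suff -> : Num.truncn (1 - x) = 0%N by rewrite addr0 big_ord0 divr1.
by apply/eqP; rewrite -leqn0 leqNgt truncn_gt_nat -ltNge gtrBl x0.
Qed.

Lemma rGamma_pole (R : realType) (m : nat) : rGamma (- m%:R : R) = 0.
Proof.
rewrite /rGamma /Gamma opprK nat1r natrK big_ord_recr /=.
by rewrite addNr mulr0 invr0 mulr0 invr0.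
Qed.

(* The Wright function W_{lambda,mu}, on real arguments; the series converges
   absolutely as soon as lambda > -1. *)
Definition Wright (R : realType) (lambda mu z : R) : R :=
  limn (series (fun n => z ^+ n / n`!%:R * rGamma (lambda * n%:R + mu))).

Definition psi (R : realType) (alpha beta t s : R) : R :=
  t `^ (beta - 1) * Wright (- alpha) beta (- (s * t `^ (- alpha))).

(* Main.v *)
Require Import Defs.
From mathcomp Require Import all_boot all_order all_algebra.
From mathcomp Require Import all_classical all_reals all_analysis.
From mathcomp Require Import measurable_realfun.
From mathcomp Require Import ring lra.

(** The scaled Wright function psi_(al, b)(t, r) is the inverse Laplace transform
    in t of z^(-b) exp(- r z^al), and in r its own Laplace transform is explicit:
    the integral of exp(- r v) psi_(ga, d)(r, s) over r > 0 is
    v^(-d) exp(- s v^ga). Writing b = beta - alpha and d = delta - gamma,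
    expressing psi_(al, b)(t, r) by the Bromwich integral over the line Re z = 1
    and exchanging the integrals, the right-hand side becomes the Bromwich
    integral of exp(t z) z^(-b) v^(-d) exp(- s v^ga) with v = z^al, that is, of
    exp(t z) z^(-b - al d) exp(- s z^(al ga)), which is the left-hand side.

    Complex quantities are carried as modulus and argument of 1 + i u, so all
    integrals are real. Apart from a rotation of the ray in Euler's integral, no
    contour is deformed; the two facts above come from Taylor expansions with
    explicit bounds.

    The Bromwich integral (phi) converges absolutely for r > 0 and every real b,
    since the real part of z^al is at least a positive multiple of |z|^al on the
    line. This gives decay in r faster than any power, which the alternating
    series defining the Wright function does not show. Differentiating in r shifts
    b by - al, and integrating a total derivative along the line gives
    t phi_b = b phi_(b+1) + al r phi_(b+1-al) (phi_rec). With this recurrence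
    everything is lifted to b >= 2, where phi is bounded and tends, as r tends to
    0, to t^(b-1) / Gamma(b) (bromwich_gamma, proved with the Poisson kernel and
    Fubini). The n-th derivative therefore grows at most like n^(al n), so that
    the Taylor series in r converges to phi (taylor_cvg), and it is the Wright
    series (psi_phi).

    The Laplace transform of psi_(ga, d)(r, s) in r, at complex v, is found in the
    same way by expanding in s (lapE): a derivative in s shifts d by - ga, an
    integration by parts in r trades a unit of d for a factor v, and as s tends
    to 0 the transform tends to v^(-d) by the complex Euler integral
    (Rintegral_gamma_cos). The closed form has the same expansion.

    The exchange of integrals is dominated because psi_(ga, d)(r, s) vanishes to
    infinite order as r tends to 0 and the Bromwich integrand decays in r. *)

Set Implicit Arguments.
Unset Strict Implicit.
Unset Printing Implicit Defensive.

Import Order.TTheory GRing.Theory Num.Theory.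
Import numFieldNormedType.Exports.
Local Open Scope classical_set_scope.
Local Open Scope ring_scope.

(** * Integration over the positive half-line *)

Section toolkit.
Context {R : realType}.
Implicit Types (f g F : R -> R) (x y C a b l : R).
Local Notation mu := (@lebesgue_measure R).
Local Notation D := (`]0%R, +oo[%classic : set R).

(** Nonnegative powers times decaying exponentials and, for [r > 0]
    or [b >= 2], the Bromwich integrands below are bounded by multiples of this
    weight, which therefore serves as the dominating function throughout. *)
Definition wt x : R := (1 + x ^+ 2)^-1.

Lemma wt_gt0 x : 0 < wt x.
Proof. by rewrite invr_gt0 ltr_pwDl// sqr_ge0. Qed.

Lemma continuous_wt : continuous wt.
Proof. by move=> x; exact: continuous_oneDsqrV. Qed.

Lemma measurable_wt (S : set R) : measurable_fun S wt.
Proof.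
by apply: measurable_funTS; apply: continuous_measurable_fun; exact: continuous_wt.
Qed.

(** Stated at the measurable type that carries the Lebesgue measure, so
    that it can be given to integration lemmas as an explicit argument. *)
Lemma measurable_itv0y : measurable (D : set (measurableTypeR R)).
Proof. exact: measurable_itv. Qed.

Lemma integrable_wt : mu.-integrable D (EFin \o wt).
Proof.
apply: (@integrableS _ _ R mu (`[0%R, +oo[%classic : set R)) => //.
  by move=> x /=; rewrite !in_itv/= !andbT => /ltW.
apply/integrableP; split.
  by apply/measurable_EFinP; apply: measurable_wt.
under eq_integral => x _ do rewrite /= ger0_norm ?(ltW (wt_gt0 x))//.
by rewrite (integral0y_oneDsqr R) ltry.
Qed.

Lemma integrable_wtZ C : mu.-integrable D (EFin \o (fun x => C * wt x)).
Proof.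
rewrite (_ : _ \o _ = (fun x => C%:E * (EFin \o wt) x)%E).
  by apply: integrableZl; [exact: measurable_itv0y|exact: integrable_wt].
by apply/funext => x /=; rewrite EFinM.
Qed.

Lemma integrable_le_wt f C : measurable_fun D f ->
  (forall x, 0 < x -> `|f x| <= C * wt x) -> mu.-integrable D (EFin \o f).
Proof.
move=> mf fC; apply: (@le_integrable _ _ _ mu _ measurable_itv0y _
   (EFin \o (fun x => C * wt x))).
- exact/measurable_EFinP.
- move=> x /=; rewrite in_itv/= andbT => x0; rewrite lee_fin.
  by rewrite (le_trans (fC _ x0))// ler_norm.
- exact: integrable_wtZ.
Qed.

Lemma Rintegral_wt : \int[mu]_(x in D) wt x = pi / 2.
Proof.
rewrite Rintegral_itv_obnd_cbnd.
  by rewrite /Rintegral (integral0y_oneDsqr R).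
exact: integrable_wt.
Qed.

Lemma le_Rintegral_wt f C : measurable_fun D f ->
  (forall x, 0 < x -> `|f x| <= C * wt x) ->
  `|\int[mu]_(x in D) f x| <= C * (pi / 2).
Proof.
move=> mf fC; have fi := integrable_le_wt mf fC.
apply: le_trans (le_normr_Rintegral measurable_itv0y fi) _.
rewrite -Rintegral_wt -(RintegralZl C measurable_itv0y integrable_wt).
apply: (le_Rintegral measurable_itv0y).
- exact: (integrable_norm fi).
- exact: integrable_wtZ.
- by move=> x /=; rewrite in_itv/= andbT; exact: fC.
Qed.

Lemma cvg_Rintegral (f_ : nat -> R -> R) f G :
  mu.-integrable D (EFin \o G) ->
  (forall n, measurable_fun D (f_ n)) ->
  (forall n x, 0 < x -> `|f_ n x| <= G x) ->
  (forall x, 0 < x -> f_ n x @[n --> \oo] --> f x) ->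
  \int[mu]_(x in D) f_ n x @[n --> \oo] --> \int[mu]_(x in D) f x.
Proof.
move=> iG mf_ fG ff.
have Dgt0 x : D x -> 0 < x by rewrite /= in_itv/= andbT.
have mf : measurable_fun D f.
  by apply: (measurable_fun_cvg mf_) => x /Dgt0 /ff.
have [|||||fi _ h] := @dominated_convergence _ _ _ mu D measurable_itv0y
  (fun n => EFin \o f_ n) (EFin \o f) (EFin \o G).
- by move=> n; apply/measurable_EFinP; apply: mf_.
- by apply/measurable_EFinP; apply: mf.
- by apply/aeW => x /Dgt0 x0; apply/cvg_EFin; [exact: nearW|exact: ff].
- exact: iG.
- by apply/aeW => x n /Dgt0 x0 /=; rewrite lee_fin; exact: fG.
apply: fine_cvg; rewrite /Rintegral fineK//.
exact: integrable_fin_num fi.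
Qed.


Lemma measurable_continuous_D f : (forall x, 0 < x -> {for x, continuous f}) ->
  measurable_fun D f.
Proof.
move=> cf; apply: open_continuous_measurable_fun; first exact: interval_open.
by move=> x; rewrite inE/= in_itv/= andbT; exact: cf.
Qed.

Lemma cvgy_shift_nat F l : F x @[x --> +oo%R] --> l ->
  F n.+2%:R @[n --> \oo] --> l.
Proof.
move=> /cvg_pinftyP; apply.
apply/cvgryPge => A; near=> n.
rewrite (@le_trans _ _ n%:R)//; last by rewrite ler_nat leqW.
by near: n; exact: nbhs_infty_ger.
Unshelve. all: by end_near. Qed.

Lemma cvg0_inv_nat F l : F x @[x --> 0^'+] --> l ->
  F n.+1%:R^-1 @[n --> \oo] --> l.
Proof.
move=> /cvg_at_rightP; apply; split; first by move=> n; rewrite invr_gt0.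
exact: cvg_harmonic.
Qed.

(** Exhaustion of the half-line by the segments
    [1/(n+1), n+2], so that no continuity at 0 is required. With [a = b = 0] it
    is integration by parts with vanishing boundary terms, the form in which it
    mostly serves. *)
Lemma Rintegral_FTC f F a b :
  (forall x, 0 < x -> is_derive x 1 F (f x)) ->
  (forall x, 0 < x -> {for x, continuous f}) ->
  mu.-integrable D (EFin \o f) ->
  F x @[x --> 0^'+] --> a -> F x @[x --> +oo%R] --> b ->
  \int[mu]_(x in D) f x = b - a.
Proof.
move=> dF cf fi Fa Fb.
pose J n : set R := `[n.+1%:R^-1, n.+2%:R]%classic.
have J0 n x : J n x -> 0 < x.
  by rewrite /J/= in_itv/= => /andP[+ _]; apply: lt_le_trans; rewrite invr_gt0.
have intJ n : \int[mu]_(x in J n) f x = F n.+2%:R - F n.+1%:R^-1.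
  have lt12 : n.+1%:R^-1 < n.+2%:R :> R.
    by rewrite (@le_lt_trans _ _ 1)// ?invf_le1// ?ler1n// ltr1n.
  have Fc x : 0 < x -> {for x, continuous F}.
    by move=> /dF /@ex_derive /derivable1_diffP /differentiable_continuous.
  rewrite /Rintegral (@continuous_FTC2 _ f F)//.
  - apply: continuous_in_subspaceT => x; rewrite inE => /J0; exact: cf.
  - split.
    + by move=> x xJ; apply: (@ex_derive _ _ _ _ _ _ (f x)); apply/dF/(J0 n)/subset_itv_oo_cc.
    + by apply: cvg_at_right_filter; apply: Fc; rewrite invr_gt0.
    + by apply: cvg_at_left_filter; apply: Fc.
  - move=> x xJ; rewrite derive1E; apply: derive_val.
    by apply/dF/(J0 n)/subset_itv_oo_cc.
have intJD n : \int[mu]_(x in J n) f x = \int[mu]_(x in D) (f x * \1_(J n) x).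
  rewrite Rintegral_mkcond [RHS]Rintegral_mkcond; apply: eq_Rintegral => x _.
  rewrite !patchE indicE; case: ifPn => [xJ|xJ].
    by rewrite ifT ?mulr1// inE/= in_itv/= andbT; exact: (J0 n) (set_mem xJ).
  by rewrite mulr0 if_same.
have h1 : \int[mu]_(x in J n) f x @[n --> \oo] --> b - a.
  under eq_cvg do rewrite intJ.
  by apply: cvgB; [exact: cvgy_shift_nat|exact: cvg0_inv_nat].
have h2 : \int[mu]_(x in J n) f x @[n --> \oo] --> \int[mu]_(x in D) f x.
  under eq_cvg do rewrite intJD.
  apply: (@cvg_Rintegral _ _ (fun x => `|f x|)).
  - exact: integrable_norm fi.
  - move=> n; apply: measurable_funM; first exact: measurable_continuous_D.
    by apply: measurable_indic; exact: measurable_itv.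
  - move=> n x x0; rewrite normrM ler_piMr//.
    by rewrite ger0_norm ?indicE//; case: (_ \in _).
  - move=> x x0; apply: cvg_near_cst; near=> n.
    rewrite indicE mem_set ?mulr1// /J/= in_itv/=; apply/andP; split.
      rewrite invf_ple ?posrE// -[leLHS]addr0 (@le_trans _ _ n%:R) ?addr0//.
        by near: n; exact: nbhs_infty_ger.
      by rewrite ler_nat.
    rewrite (@le_trans _ _ n%:R)//; last by rewrite ler_nat leqW.
    by near: n; exact: nbhs_infty_ger.
exact: cvg_unique h2 h1.
Unshelve. all: by end_near. Qed.

Lemma is_derive_Rintegral (f df : R -> R -> R) a u v C : u < a < v ->
  (forall x, u < x < v -> mu.-integrable D (EFin \o f x)) ->
  (forall x y, u < x < v -> 0 < y -> is_derive x 1 (f ^~ y) (df x y)) ->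
  (forall x y, u < x < v -> 0 < y -> `|df x y| <= C * wt y) ->
  is_derive a 1 (fun x => \int[mu]_(y in D) f x y) (\int[mu]_(y in D) df a y).
Proof.
move=> uav fi fd fC.
have C0 : 0 <= C.
  have /(_ a 1 uav ltr01) := fC; move/(le_trans (normr_ge0 _)).
  by rewrite pmulr_lge0// wt_gt0.
have Dgt0 x : D x -> 0 < x by rewrite /= in_itv/= andbT.
have I x : (`]u, v[%classic : set R) x -> u < x < v by rewrite /= in_itv.
have d1 x y : u < x < v -> 0 < y -> partial1of2 f x y = df x y.
  by move=> xI y0; rewrite partial1of2E; apply: derive_val; exact: fd.
have aI : (`]u, v[%classic : set R) a by rewrite /= in_itv.
have h1 x : (`]u, v[%classic : set R) x -> mu.-integrable D (EFin \o f x) by move/I/fi.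
have h2 x y : (`]u, v[%classic : set R) x -> D y -> derivable (f ^~ y) x 1.
  by move=> /I xI /Dgt0 y0; have := fd _ _ xI y0 => /@ex_derive.
have h3 y : 0 <= C * wt y by rewrite mulr_ge0// ltW// wt_gt0.
have h4 x y : (`]u, v[%classic : set R) x -> D y -> `|partial1of2 f x y| <= C * wt y.
  by move=> /I xI /Dgt0 y0; rewrite d1//; exact: fC.
apply: DeriveDef.
  exact: (derivable_under_integral measurable_itv0y aI h1 h2 h3 (integrable_wtZ C) h4).
rewrite -derive1E.
rewrite (differentiation_under_integral measurable_itv0y aI h1 h2 h3 (integrable_wtZ C) h4).
by apply: eq_Rintegral => y /set_mem /Dgt0 y0; rewrite d1.
Qed.

(** Domination by a product of one-variable functions
    makes Tonelli's theorem immediate; this form avoids integrability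
    over the plane as a hypothesis. *)
Lemma Rintegral_fubini (F : R -> R -> R) (g h : R -> R) :
  measurable_fun setT (fun z : R * R => F z.1 z.2) ->
  mu.-integrable D (EFin \o g) -> mu.-integrable D (EFin \o h) ->
  (forall x, 0 < x -> 0 <= g x) -> (forall y, 0 < y -> 0 <= h y) ->
  (forall x y, 0 < x -> 0 < y -> `|F x y| <= g x * h y) ->
  \int[mu]_(x in D) \int[mu]_(y in D) F x y =
  \int[mu]_(y in D) \int[mu]_(x in D) F x y.
Proof.
move=> mF ig ih g0 h0 Fgh.
have Dgt0 x : D x -> 0 < x by rewrite /= in_itv/= andbT.
have DE x : (x \in D) = (0 < x) by apply/idP/idP => [/set_mem/Dgt0//|x0]; apply/mem_set; rewrite /= in_itv/= x0.
(* Extension by 0 to the plane, where Fubini applies. *)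
pose G z := F z.1 z.2 * \1_D z.1 * \1_D z.2.
have mG : measurable_fun setT G.
  apply: measurable_funM; first apply: measurable_funM => //.
    by apply: measurableT_comp => //; exact: measurable_indic.
  by apply: measurableT_comp => //; exact: measurable_indic.
have patch_int k : mu.-integrable D (EFin \o k) ->
    mu.-integrable setT (fun x => (k x * \1_D x)%:E).
  move=> ik; rewrite (_ : (fun x => _) = (EFin \o k) \_ D).
    by apply/(integrable_mkcond _ measurable_itv0y).
  apply/funext => x; rewrite patchE indicE.
  by case: (x \in D); rewrite ?mulr1// mulr0.
have Gle x y : (`|(G (x, y))%:E| <= (g x * \1_D x * (h y * \1_D y))%:E)%E.
  rewrite abse_EFin lee_fin /G/= !indicE !DE.
  case: ltP => x0; last by rewrite !mulr0 !mul0r normr0.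
  case: ltP => y0; last by rewrite !mulr0 normr0.
  by rewrite !mulr1; exact: Fgh.
have ge0g x : 0 <= g x * \1_D x.
  by rewrite indicE DE; case: ltP => x0; rewrite ?mulr1 ?mulr0// g0.
have ge0h x : 0 <= h x * \1_D x.
  by rewrite indicE DE; case: ltP => x0; rewrite ?mulr1 ?mulr0// h0.
have mh := measurable_int _ (patch_int _ ih).
have mg := measurable_int _ (patch_int _ ig).
have mGE : measurable_fun setT (EFin \o G) by apply/measurable_EFinP.
have iG : (mu \x mu)%E.-integrable setT (EFin \o G).
  apply/integrable12ltyP => //.
  apply: (@le_lt_trans _ _ (\int[mu]_x ((g x * \1_D x)%:E * \int[mu]_y (h y * \1_D y)%:E))%E).
    apply: ge0_le_integral => //.
    - by move=> x _; exact: integral_ge0.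
    - have := @measurable_fun_fubini_tonelli_F _ _ _ _ R mu (abse \o (EFin \o G)).
      by apply => //=; apply: measurableT_comp.
    - by apply: emeasurable_funM => //; exact: measurable_cst.
    - move=> x _; rewrite -ge0_integralZl//;
        [|by move=> y _; rewrite lee_fin|by rewrite lee_fin].
      apply: ge0_le_integral => //.
      + by apply: measurableT_comp => //; apply: measurableT_comp => //;
          exact: measurable_pair1.
      + by apply: emeasurable_funM => //; exact: measurable_cst.
      + by move=> y _; rewrite -EFinM; exact: Gle.
  have /integrableP[_] := patch_int _ ih.
  under eq_integral => y _ do rewrite gee0_abs ?lee_fin//.
  move=> hlt; rewrite ge0_integralZr//.
  - apply: lte_mul_pinfty => //.
    + by apply: integral_ge0 => x _; rewrite lee_fin.
    + exact: (integrable_fin_num _ (patch_int _ ig)).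
  - by move=> x _; rewrite lee_fin.
  - by apply: integral_ge0 => x _; rewrite lee_fin.
have FD k : \int[mu]_(x in D) k x = fine (\int[mu]_x (k x * \1_D x)%:E).
  rewrite /Rintegral integral_mkcond; congr fine; apply: eq_integral => x _.
  by rewrite patchE indicE; case: (x \in D); rewrite ?mulr1// mulr0.
have FG1 x : 0 < x -> (\int[mu]_(y in D) F x y)%:E = (\int[mu]_y (G (x, y))%:E)%E.
  move=> x0.
  have -> : (\int[mu]_y (G (x, y))%:E = \int[mu]_(y in D) (F x y)%:E)%E.
    rewrite [RHS]integral_mkcond; apply: eq_integral => y _.
    rewrite patchE /G/= !indicE [x \in D]DE x0.
    by case: (y \in D); rewrite ?mulr1 ?mulr0.
  rewrite /Rintegral fineK//; apply: integrable_fin_num => //.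
  apply: (@le_integrable _ _ _ mu _ measurable_itv0y _ (EFin \o (fun y => g x * h y))).
  - apply/measurable_EFinP; apply: measurable_funTS.
    exact: (measurableT_comp mF (measurable_pair1 x)).
  - move=> y /= /Dgt0 y0; rewrite lee_fin (le_trans (Fgh _ _ x0 y0))//.
    exact: ler_norm.
  - have := integrableZl measurable_itv0y (g x) ih.
    by congr (_.-integrable _ _); apply/funext => y /=; rewrite EFinM.
have FG2 y : 0 < y -> (\int[mu]_(x in D) F x y)%:E = (\int[mu]_x (G (x, y))%:E)%E.
  move=> y0.
  have -> : (\int[mu]_x (G (x, y))%:E = \int[mu]_(x in D) (F x y)%:E)%E.
    rewrite [RHS]integral_mkcond; apply: eq_integral => x _.
    rewrite patchE /G/= !indicE [y \in D]DE y0.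
    by case: (x \in D); rewrite ?mulr1 ?mulr0 ?mul0r.
  rewrite /Rintegral fineK//; apply: integrable_fin_num => //.
  apply: (@le_integrable _ _ _ mu _ measurable_itv0y _ (EFin \o (fun x => g x * h y))).
  - apply/measurable_EFinP; apply: measurable_funTS.
    exact: (measurableT_comp mF (measurable_pair2 y)).
  - move=> x /= /Dgt0 x0; rewrite lee_fin (le_trans (Fgh _ _ x0 y0))//.
    exact: ler_norm.
  - have := integrableZr measurable_itv0y (h y) ig.
    by congr (_.-integrable _ _); apply/funext => x /=; rewrite EFinM.
rewrite !FD; congr fine.
transitivity (\int[mu]_x \int[mu]_y (G (x, y))%:E)%E.
  apply: eq_integral => x _; rewrite indicE DE; case: ltP => x0.
    by rewrite mulr1 FG1.
  rewrite mulr0 -[LHS](integral0 mu setT); apply: eq_integral => y _.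
  by rewrite /G/= !indicE [x \in D]DE ltNge x0 mulr0 mul0r.
rewrite (Fubini iG).
apply: eq_integral => y _; rewrite indicE DE; case: ltP => y0.
  by rewrite mulr1 FG2.
rewrite mulr0 -[RHS](integral0 mu setT); apply: eq_integral => x _.
by rewrite /G/= !indicE [y \in D]DE ltNge y0 mulr0.
Qed.
End toolkit.

(** * Differentiation, measurability and growth rules *)

Section derive_rules.
Context {R : realType}.
Implicit Types (f g : R -> R) (x a b : R).

Lemma der_cst x c : is_derive x 1 (fun _ : R => c) (0 : R).
Proof. exact: is_derive_cst. Qed.

Lemma der_id x : is_derive x 1 (fun y : R => y) (1 : R).
Proof. exact: is_derive_id. Qed.

Lemma derD f g x a b : is_derive x 1 f a -> is_derive x 1 g b ->
  is_derive x 1 (fun y => f y + g y) (a + b).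
Proof. by move=> *; exact: is_deriveD. Qed.

Lemma derN f x a : is_derive x 1 f a -> is_derive x 1 (fun y => - f y) (- a).
Proof. by move=> *; exact: is_deriveN. Qed.

Lemma derMl c x : is_derive x 1 ( *%R c) (c : R).
Proof.
apply: (is_derive_eq (@is_deriveZ _ _ _ id c x 1 1 _)).
by rewrite /GRing.scale/= mulr1.
Qed.

Lemma derNid x : is_derive x 1 ( -%R : R -> R) (- 1 : R).
Proof. exact: (is_deriveN (is_derive_id x 1)). Qed.

Lemma derM f g x a b : is_derive x 1 f a -> is_derive x 1 g b ->
  is_derive x 1 (fun y => f y * g y) (a * g x + f x * b).
Proof.
move=> fa gb; apply: (is_derive_eq (is_deriveM fa gb)).
by rewrite addrC /GRing.scale/= (mulrC a).
Qed.

Lemma der_comp h f x a b : is_derive x 1 f a -> is_derive (f x) 1 h b ->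
  is_derive x 1 (fun y => h (f y)) (b * a).
Proof. by move=> fa hb; exact: (@is_derive1_comp _ h f). Qed.

Lemma der_expR f x a : is_derive x 1 f a ->
  is_derive x 1 (fun y => expR (f y)) (expR (f x) * a).
Proof. by move=> fa; apply: der_comp. Qed.

Lemma der_cos f x a : is_derive x 1 f a ->
  is_derive x 1 (fun y => cos (f y)) (- sin (f x) * a).
Proof. by move=> fa; apply: der_comp. Qed.

Lemma der_sin f x a : is_derive x 1 f a ->
  is_derive x 1 (fun y => sin (f y)) (cos (f x) * a).
Proof. by move=> fa; apply: der_comp. Qed.

Lemma der_atan f x a : is_derive x 1 f a ->
  is_derive x 1 (fun y => atan (f y)) ((1 + f x ^+ 2)^-1 * a).
Proof. by move=> fa; apply: der_comp. Qed.

Lemma der_powR p f x a : 0 < f x -> is_derive x 1 f a ->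
  is_derive x 1 (fun y => f y `^ p) (p * f x `^ (p - 1) * a).
Proof.
by move=> fx0 fa; apply: (@der_comp (fun z => z `^ p)) => //; apply: is_derive1_powR.
Qed.

Lemma derV f x a : f x != 0 -> is_derive x 1 f a ->
  is_derive x 1 (fun y => (f y)^-1) (- (f x)^-1 ^+ 2 * a).
Proof. by move=> f0 fa; apply: (is_derive_eq (is_deriveV f0 fa)); rewrite exprVn. Qed.

Lemma der_sqr f x a : is_derive x 1 f a ->
  is_derive x 1 (fun y => f y ^+ 2) (2 * f x * a).
Proof. by move=> fa; apply: (is_derive_eq (derM fa fa)); ring. Qed.

Lemma der_continuous f x a : is_derive x 1 f a -> {for x, continuous f}.
Proof. by move=> /@ex_derive /derivable1_diffP /differentiable_continuous. Qed.

End derive_rules.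

(** Syntax-directed differentiation; the side conditions (positive base of a
    power, nonzero denominator) and the derivatives of unknown functions are
    left. The branches for bare constants such as [@cos _] catch functions that
    unification has eta-contracted. *)
Ltac dtac := lazymatch goal with
  | |- is_derive _ _ (fun _ => ?c) _ => exact: der_cst
  | |- is_derive _ _ (fun y => y) _ => exact: der_id
  | |- is_derive _ _ (GRing.mul _) _ => exact: derMl
  | |- is_derive _ _ (@Algebra.opp _) _ => exact: derNid
  | |- is_derive _ _ (@cos _) _ => exact: is_derive_cos
  | |- is_derive _ _ (@sin _) _ => exact: is_derive_sin
  | |- is_derive _ _ (@atan _) _ => exact: is_derive1_atan
  | |- is_derive _ _ (fun y => _ + _) _ => eapply derD; dtac
  | |- is_derive _ _ (fun y => - _) _ => eapply derN; dtac
  | |- is_derive _ _ (fun y => _ * _) _ => eapply derM; dtac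
  | |- is_derive _ _ (fun y => (_)^-1) _ => eapply derV; [|dtac]
  | |- is_derive _ _ (fun y => _ ^+ 2) _ => apply: der_sqr; dtac
  | |- is_derive _ _ (fun y => expR _) _ => eapply der_expR; dtac
  | |- is_derive _ _ (fun y => cos _) _ => eapply der_cos; dtac
  | |- is_derive _ _ (fun y => sin _) _ => eapply der_sin; dtac
  | |- is_derive _ _ (fun y => atan _) _ => eapply der_atan; dtac
  | |- is_derive _ _ (fun y => powR _ _) _ => eapply der_powR; [|dtac]
  | |- _ => idtac
  end.

Ltac derive_by := eapply is_derive_eq; [dtac|cbv beta].

Section measurable_rules.
Context {R : realType} {d : measure_display} {T : measurableType d}.
Implicit Types (S : set T) (f : T -> R).

Lemma measurable_comp_continuous (h : R -> R) f S : continuous h ->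
  measurable_fun S f -> measurable_fun S (fun x => h (f x)).
Proof.
by move=> ch mf; apply: (measurableT_comp (continuous_measurable_fun ch) mf).
Qed.

Lemma measurable_powR_comp p f S :
  measurable_fun S f -> measurable_fun S (fun x => f x `^ p).
Proof. by move=> mf; apply: (measurableT_comp (measurable_powR p) mf). Qed.

End measurable_rules.

Ltac mtac := lazymatch goal with
  | |- measurable_fun _ (fun z => _ + _) => apply: measurable_funD; mtac
  | |- measurable_fun _ (fun z => - _) => apply: measurableT_comp; mtac
  | |- measurable_fun _ (fun z => _ * _) => apply: measurable_funM; mtac
  | |- measurable_fun _ (fun z => expR _) =>
      apply: (measurable_comp_continuous (@continuous_expR _)); mtac
  | |- measurable_fun _ (fun z => cos _) =>
      apply: (measurable_comp_continuous (@continuous_cos _)); mtac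
  | |- measurable_fun _ (fun z => sin _) =>
      apply: (measurable_comp_continuous (@continuous_sin _)); mtac
  | |- measurable_fun _ (fun z => atan _) =>
      apply: (measurable_comp_continuous (fun x => @continuous_atan _ x)); mtac
  | |- measurable_fun _ (fun z => powR _ _) => apply: measurable_powR_comp; mtac
  | |- measurable_fun _ (fun _ => ?c) => exact: measurable_cst
  | |- measurable_fun _ _ => try done
  end.

Section growth.
Context {R : realType}.
Implicit Types (p k x : R).

Lemma powRD_gt0 x p k : 0 < x -> x `^ (p + k) = x `^ p * x `^ k.
Proof. by move=> x0; rewrite powRD// (gt_eqF x0) implybT. Qed.

(** The maximum is at [x = p]; the bound is the inequality
    [ln y <= y - 1] at [y = x / p]. *)
Lemma powR_expR_bounded p : 0 <= p ->
  exists2 K, 0 <= K & forall x, 0 < x -> x `^ p * expR (- x) <= K.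
Proof.
rewrite le_eqVlt => /predU1P[<-|p0].
  exists 1 => // x x0; rewrite powRr0 mul1r expR_le1 oppr_le0; exact: ltW.
exists (expR (p * ln p)); first exact: expR_ge0.
move=> x x0; rewrite /powR gt_eqF// -expRD ler_expR.
have h : ln (x / p) <= x / p - 1.
  have /le_ln1Dx : -1 < x / p - 1 by have := divr_gt0 x0 p0; lra.
  by rewrite (addrC 1) subrK.
move: h; rewrite ln_div ?posrE// => h.
have : p * (ln x - ln p) <= p * (x / p - 1) by rewrite ler_pM2l.
rewrite !mulrBr mulr1 mulrCA divff ?gt_eqF// mulr1; lra.
Qed.

Lemma expR_le_powR k p : 0 < k -> 0 <= p ->
  exists2 K, 0 <= K & forall x, 0 < x -> expR (- (k * x)) <= K * x `^ (- p).
Proof.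
move=> k0 /powR_expR_bounded[K K0 KP].
exists (K * k `^ (- p)); first by rewrite mulr_ge0// powR_ge0.
move=> x x0; have kx0 : 0 < k * x by rewrite mulr_gt0.
rewrite -mulrA -(powRM _ (ltW k0) (ltW x0)) powRN ler_pdivlMr ?powR_gt0//.
by rewrite mulrC; exact: KP.
Qed.

Lemma powR_expR_le_wt p k : 0 <= p -> 0 < k ->
  exists2 K, 0 <= K & forall x, 0 < x -> x `^ p * expR (- (k * x)) <= K * wt x.
Proof.
move=> p0 k0.
have [K1 K10 h1] := expR_le_powR k0 p0.
have [K2 K20 h2] := expR_le_powR k0 (addr_ge0 p0 (ler0n _ 2)).
exists (K1 + K2); first by rewrite addr_ge0.
move=> x x0.
have w0 : 0 < 1 + x ^+ 2 by rewrite ltr_pwDl// sqr_ge0.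
rewrite /wt ler_pdivlMr// mulrDr mulr1 lerD//.
  rewrite (le_trans (ler_wpM2l (powR_ge0 _ _) (h1 _ x0)))//.
  by rewrite mulrCA powRN divff ?mulr1// gt_eqF// powR_gt0.
rewrite mulrAC -(powR_mulrn _ (ltW x0)) -powRD_gt0//.
rewrite (le_trans (ler_wpM2l (powR_ge0 _ _) (h2 _ x0)))//.
by rewrite mulrCA powRN divff ?mulr1// gt_eqF// powR_gt0.
Qed.

Lemma cvg0_powR_bound (F : R -> R) K p : 0 < p ->
  (forall x, 0 < x -> `|F x| <= K * x `^ p) -> F x @[x --> 0^'+] --> (0 : R).
Proof.
move=> p0 FK; apply: norm_cvg0.
have h0 : K * x `^ p @[x --> 0^'+] --> (0 : R).
  by rewrite -[X in _ --> X](mulr0 K); apply: cvgM; [exact: cvg_cst|exact: powR_cvg0].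
apply: (squeeze_cvgr _ (cvg_cst 0) h0).
by near=> x; rewrite normr_ge0/= FK.
Unshelve. all: by end_near. Qed.

Lemma cvgy_wt_bound (F : R -> R) K :
  (forall x, 0 < x -> `|F x| <= K * wt x) -> F x @[x --> +oo%R] --> (0 : R).
Proof.
move=> FK.
have K0 : 0 <= K.
  by move: (FK 1 ltr01) => /(le_trans (normr_ge0 _)); rewrite pmulr_lge0// wt_gt0.
apply/cvgrPdist_le => e e0; near=> x.
have x1 : 1 <= x by near: x; apply: nbhs_pinfty_ge; rewrite num_real.
have x0 : 0 < x by apply: lt_le_trans x1.
rewrite sub0r normrN (le_trans (FK x x0))// /wt ler_pdivrMr ?ltr_pwDl ?sqr_ge0//.
rewrite -ler_pdivrMl//.
have : e^-1 * K <= x by near: x; apply: nbhs_pinfty_ge; rewrite num_real.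
move=> /le_trans; apply; rewrite expr2.
have : x * 1 <= x * x by rewrite ler_pM2l.
lra.
Unshelve. all: by end_near. Qed.

End growth.

(** * Euler integrals along rays *)

Section gamma_integrals.
Context {R : realType}.
Implicit Types (p m x w : R).
Local Notation mu := (@lebesgue_measure R).
Local Notation D := (`]0%R, +oo[%classic : set R).

Lemma is_derive0_eq (f : R -> R) (u v x y : R) :
  (forall z, u < z < v -> is_derive z 1 f (0 : R)) ->
  u < x < v -> u < y < v -> f x = f y.
Proof.
move=> df; wlog xy : x y / x < y.
  move=> h xI yI; have [?|?|->//] := ltgtP x y; first exact: h.
  by apply/esym; exact: h.
move=> /andP[ux xv] /andP[uy yv].
have sub z : x <= z <= y -> u < z < v.
  by move=> /andP[xz zy]; rewrite (lt_le_trans ux xz) (le_lt_trans zy yv).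
have [||c _] := @MVT _ f (fun=> 0) _ _ xy.
- by move=> z; rewrite in_itv/= => /andP[/ltW xz /ltW zy]; apply/df/sub/andP.
- apply: continuous_in_subspaceT => z; rewrite inE/= in_itv/= => zI.
  exact: der_continuous (df _ (sub _ zI)).
- by rewrite mul0r => /eqP; rewrite subr_eq0 => /eqP.
Qed.

Lemma le_cos x v : v <= pi -> `|x| <= v -> cos v <= cos x :> R.
Proof.
move=> vpi xv; rewrite -(cos_norm x) leNgt ltr_cos ?in_itv/= -?leNgt//.
- by rewrite (le_trans _ xv)//.
- by rewrite normr_ge0 (le_trans xv).
Qed.

Lemma norm_mul_cos (a b : R) : `|a * cos b| <= `|a|.
Proof. by rewrite normrM ler_piMr// cos_max. Qed.

Lemma norm_mul_sin (a b : R) : `|a * sin b| <= `|a|.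
Proof. by rewrite normrM ler_piMr// sin_max. Qed.

Lemma dominated_expR_cos p c : 0 <= p -> 0 < c ->
  exists2 K, 0 <= K & forall s w x, 0 < x ->
    `|x `^ p * expR (- (c * x)) * cos (s * x + w)| <= K * wt x.
Proof.
move=> p0 c0; have [K K0 KP] := powR_expR_le_wt p0 c0; exists K => // s w x x0.
rewrite (le_trans (norm_mul_cos _ _))// ger0_norm ?KP//.
by rewrite mulr_ge0 ?powR_ge0 ?expR_ge0.
Qed.

Lemma measurable_expR_cos p c s w :
  measurable_fun D (fun x => x `^ p * expR (- (c * x)) * cos (s * x + w)).
Proof.
apply: measurable_continuous_D => x x0; apply: der_continuous; dtac; exact: x0.
Qed.

Lemma integrable_expR_cos p c s w : 0 <= p -> 0 < c ->
  mu.-integrable D (EFin \o (fun x => x `^ p * expR (- (c * x)) * cos (s * x + w))).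
Proof.
move=> p0 c0; have [K K0 KP] := dominated_expR_cos p0 c0.
exact: integrable_le_wt (measurable_expR_cos _ _ _ _) (KP _ _).
Qed.

Lemma integrable_expR_powR p c : 0 <= p -> 0 < c ->
  mu.-integrable D (EFin \o (fun x => x `^ p * expR (- (c * x)))).
Proof.
move=> p0 c0; have := integrable_expR_cos 0 0 p0 c0.
congr (_.-integrable _ _); apply/funext => x /=.
by rewrite mul0r addr0 cos0 mulr1.
Qed.

(** Cauchy's theorem in a sector, in real terms: the left
    side is the real part of [exp (i w)] times the Euler integral of
    [z ^ p * exp (- m z)] along the ray of argument [- th]. Its derivative in
    [th] is the integral of the derivative in [x] of
    [x ^ (p + 1) * exp (- m x cos th) * sin (m x sin th + w - (p + 1) th)],
    which vanishes at both ends. *)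
Lemma rotate_gamma_integral p m th w : 0 <= p -> 0 < m ->
  - (pi / 2) < th < pi / 2 ->
  \int[mu]_(x in D) (x `^ p * expR (- (m * cos th * x)) *
     cos (m * sin th * x + (w - (p + 1) * th))) =
  \int[mu]_(x in D) (x `^ p * expR (- (m * x)) * cos w).
Proof.
move=> p0 m0 thI; set q := p + 1.
pose y a := \int[mu]_(x in D) (x `^ p * expR (- (m * cos a * x)) *
     cos (m * sin a * x + (w - q * a))).
have pi2 : 0 < pi / 2 :> R by rewrite divr_gt0// pi_gt0.
have -> : \int[mu]_(x in D) (x `^ p * expR (- (m * x)) * cos w) = y 0.
  apply: eq_Rintegral => x _; rewrite cos0 sin0 mulr1 !mulr0 mul0r.
  by rewrite subr0 add0r.
rewrite -/(y th).
apply: (@is_derive0_eq y (- (pi / 2)) (pi / 2)) => //; last first.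
  by rewrite pi2 oppr_lt0 pi2.
move=> a aI.
(* On [-v, v], a neighbourhood of a, the cosine is bounded below. *)
pose v := (`|a| + pi / 2) / 2.
have av : `|a| < pi / 2 by rewrite ltr_norml.
have v1 : `|a| < v by rewrite /v; lra.
have v2 : v < pi / 2 by rewrite /v; lra.
have v0 : 0 <= v by rewrite (le_trans _ (ltW v1)).
have cv : 0 < cos v by apply: cos_gt0_pihalf; lra.
have mcv : 0 < m * cos v by rewrite mulr_gt0.
have cle b : - v < b < v -> cos v <= cos b.
  move=> bv; apply: le_cos; last by rewrite ltW// ltr_norml.
  by have := pi_gt0 R; lra.
have cpos b : - v < b < v -> 0 < m * cos b.
  by move=> /cle cb; rewrite mulr_gt0// (lt_le_trans cv).
pose df b x := x `^ p * expR (- (m * cos b * x)) *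
   (q * sin (m * sin b * x + (w - q * b)) -
    m * x * sin (m * sin b * x + (w - q * b) - b)).
have [K1 K10 h1] := powR_expR_le_wt p0 mcv.
have [K2 K20 h2] := powR_expR_le_wt (addr_ge0 p0 ler01) mcv.
have q0 : 0 < q by rewrite /q; lra.
have dfle b x : - v < b < v -> 0 < x -> `|df b x| <= (K1 * q + m * K2) * wt x.
  move=> bv x0; rewrite /df normrM ger0_norm ?mulr_ge0 ?powR_ge0 ?expR_ge0//.
  apply: (@le_trans _ _ (x `^ p * expR (- (m * cos v * x)) * (q + m * x))).
    apply: ler_pM; rewrite ?mulr_ge0 ?powR_ge0 ?expR_ge0//.
      rewrite ler_wpM2l ?powR_ge0// ler_expR lerN2 ler_wpM2r ?(ltW x0)//.
      by rewrite ler_wpM2l ?(ltW m0)// cle.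
    rewrite (le_trans (ler_normB _ _))// lerD//.
      by rewrite (le_trans (norm_mul_sin _ _))// gtr0_norm.
    by rewrite (le_trans (norm_mul_sin _ _))// gtr0_norm// mulr_gt0.
  rewrite mulrDr mulrDl lerD//.
    by rewrite [leRHS]mulrAC ler_wpM2r ?(ltW q0)// h1.
  rewrite (_ : _ * (m * x) = m * (x `^ (p + 1) * expR (- (m * cos v * x)))).
    by rewrite -[leRHS]mulrA ler_wpM2l ?(ltW m0)// h2.
  by rewrite powRD_gt0// powRr1 ?(ltW x0)//; ring.
suff <- : \int[mu]_(x in D) df a x = 0.
  apply: (@is_derive_Rintegral _ (fun b x => x `^ p * expR (- (m * cos b * x)) *
     cos (m * sin b * x + (w - q * b))) df a (- v) v) => //.
  - by rewrite -ltr_norml.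
  - by move=> b bv; apply: integrable_expR_cos => //; exact: cpos.
  - move=> b x bv x0; derive_by.
    rewrite /df sinB; ring.
  - exact: dfle.
pose F x := x `^ q * expR (- (m * cos a * x)) * sin (m * sin a * x + (w - q * a)).
have avI : - v < a < v by rewrite -ltr_norml.
have dF x : 0 < x -> is_derive x 1 F (df a x).
  move=> x0; rewrite /F; derive_by; first exact: x0.
  rewrite /df sinB /q addrK powRD_gt0// powRr1 ?(ltW x0)//; ring.
rewrite (@Rintegral_FTC _ (df a) F 0 0) ?subr0//.
- move=> x x0; eapply der_continuous.
  by rewrite /df; dtac; exact: x0.
- apply: integrable_le_wt (fun x => dfle _ x avI).
  apply: measurable_continuous_D => x x0; eapply der_continuous.
  by rewrite /df; dtac; exact: x0.
- apply: (@cvg0_powR_bound _ F 1 q) => // x x0.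
  rewrite (le_trans (norm_mul_sin _ _))// mul1r normrM !ger0_norm ?powR_ge0 ?expR_ge0//.
  rewrite ler_piMr ?powR_ge0// expR_le1 oppr_le0.
  by rewrite mulr_ge0 ?(ltW x0)// ltW// cpos.
- have [K K0 hK] := powR_expR_le_wt (ltW q0) (cpos _ avI).
  apply: (@cvgy_wt_bound _ F K) => x x0.
  rewrite (le_trans (norm_mul_sin _ _))// normrM !ger0_norm ?powR_ge0 ?expR_ge0//.
  exact: hK.
Qed.
End gamma_integrals.

(** * The recurrence of the reciprocal Gamma function *)

Section gamma_recurrence.
Context {R : realType}.
Implicit Types (p m x w : R).
Local Notation mu := (@lebesgue_measure R).
Local Notation D := (`]0%R, +oo[%classic : set R).

(** A nonnegative derivative of a function with finite limits
    is integrable, by monotone convergence. This is how integrands that are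
    unbounded at 0 are handled. *)
Lemma integrable_FTC (f F : R -> R) (a b : R) :
  (forall x, 0 < x -> 0 <= f x) ->
  (forall x, 0 < x -> is_derive x 1 F (f x)) ->
  (forall x, 0 < x -> {for x, continuous f}) ->
  F x @[x --> 0^'+] --> a -> F x @[x --> +oo%R] --> b ->
  mu.-integrable D (EFin \o f).
Proof.
move=> f0 dF cf Fa Fb.
pose J n : set R := `[n.+1%:R^-1, +oo[%classic.
have n0 n : 0 < n.+1%:R^-1 :> R by rewrite invr_gt0.
have J0 n x : J n x -> 0 < x.
  by rewrite /J/= in_itv/= andbT; apply: lt_le_trans.
have JD : \bigcup_n J n = D.
  apply/seteqP; split=> [x [n _ /J0 x0]|x]; first by rewrite /= in_itv/= x0.
  rewrite /= in_itv/= andbT => x0.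
  (* x lies in the n-th set as soon as 1 / x < n + 1. *)
  exists (Num.truncn x^-1) => //; rewrite /J/= in_itv/= andbT.
  rewrite invf_ple ?posrE//; apply: ltW.
  by have /truncn_itv/andP[] : 0 <= x^-1 by rewrite invr_ge0 ltW.
have mf := measurable_continuous_D cf.
have intJ n : (\int[mu]_(x in J n) (f x)%:E = (b - F n.+1%:R^-1)%:E)%E.
  have gtn x : n.+1%:R^-1 < x -> 0 < x by apply: lt_trans.
  rewrite EFinB (@ge0_continuous_FTC2y _ f F _ b)//.
  - by move=> x nx; apply: f0; apply: (lt_le_trans (n0 n)).
  - apply/continuous_within_itvcyP; split.
      by move=> x; rewrite in_itv/= andbT => /gtn/cf.
    by apply: cvg_at_right_filter; exact: cf.
  - by move=> x /gtn /dF /@ex_derive.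
  - by apply: cvg_at_right_filter; exact: der_continuous (dF _ (n0 n)).
  - move=> x; rewrite in_itv/= andbT => /gtn /dF h.
    by rewrite derive1E derive_val.
have mJ n : measurable_fun (J n) (EFin \o f).
  apply/measurable_EFinP; apply: measurable_funS mf; first exact: measurable_itv0y.
  by move=> x /J0 x0; rewrite /= in_itv/= x0.
have h1 : (\int[mu]_(x in J n) (f x)%:E @[n --> \oo] --> (b - a)%:E)%E.
  under eq_cvg do rewrite intJ.
  apply: cvg_EFin; first exact: nearW.
  by apply: cvgB; [exact: cvg_cst|exact: cvg0_inv_nat].
have h2 : (\int[mu]_(x in J n) (f x)%:E @[n --> \oo] --> \int[mu]_(x in D) (f x)%:E)%E.
  rewrite -JD; have H := @ge0_nondecreasing_set_cvg_integral _ (measurableTypeR R) R J (EFin \o f) mu.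
  refine (H _ _ _ _).
  - apply/nondecreasing_seqP => n; rewrite subsetEset => x.
    rewrite /J/= !in_itv/= !andbT; apply: le_trans.
    by rewrite lef_pV2 ?posrE// ler_nat.
  - by move=> n; exact: measurable_itv.
  - by [].
  - by move=> n x /J0/f0; rewrite lee_fin.
have hE : (\int[mu]_(x in D) (f x)%:E = (b - a)%:E)%E.
  exact: (cvg_unique (@ereal_hausdorff R) h2 h1).
apply/integrableP; split; first exact/measurable_EFinP.
have -> : (\int[mu]_(x in D) `|(EFin \o f) x| = \int[mu]_(x in D) (f x)%:E)%E.
  apply: eq_integral => x; rewrite inE/= in_itv/= andbT => /f0 ?.
  by rewrite ger0_norm.
by rewrite hE ltry.
Qed.

(** Below 1 the power is unbounded at 0; up to a constant the
    integrand is below the derivative of [atan u ^ x], since [atan u <= u] and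
    [x - 1 < 0]. *)
Lemma integrable_euler x : 0 < x ->
  mu.-integrable D (EFin \o (fun u => u `^ (x - 1) * expR (- u))).
Proof.
move=> x0.
have [x1|x1] := leP 1 x.
  have x1' : 0 <= x - 1 by rewrite subr_ge0.
  have := integrable_expR_powR x1' ltr01.
  by congr (_.-integrable _ _); apply/funext => u /=; rewrite mul1r.
have atan0_lt (u : R) : 0 < u -> 0 < atan u by move=> u0; rewrite -atan0 lt_atan.
have atan_le (u : R) : 0 < u -> atan u <= u.
  move=> u0; have [|c _] := @MVT R atan (fun y => (1 + y ^+ 2)^-1) _ _ u0
    (fun y _ => is_derive1_atan y).
    by apply: continuous_in_subspaceT => y _; exact: continuous_atan.
  rewrite atan0 !subr0 => ->; rewrite ler_piMl ?(ltW u0)//.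
  by rewrite invf_le1 ?lerDl ?sqr_ge0// ltr_pwDl ?sqr_ge0.
pose G (u : R) := atan u `^ x.
pose g (u : R) := x * atan u `^ (x - 1) * (1 + u ^+ 2)^-1.
have g0 (u : R) : 0 < u -> 0 <= g u.
  by move=> u0; rewrite !mulr_ge0 ?powR_ge0 ?(ltW x0)// ltW// wt_gt0.
have gi : mu.-integrable D (EFin \o g).
  apply: (@integrable_FTC g G 0 ((pi / 2) `^ x) g0).
  - by move=> u u0; rewrite /G; derive_by; [exact: atan0_lt|rewrite /g; ring].
  - move=> u u0; apply: continuousM; last exact: continuous_wt.
    by eapply der_continuous; dtac; exact: atan0_lt.
  - apply: (@cvg0_powR_bound _ G 1 x) => // u u0.
    rewrite mul1r ger0_norm ?powR_ge0//.
    by apply: ge0_ler_powR; rewrite ?nnegrE ?atan_le ?(ltW x0) ?(ltW u0)// ltW// atan0_lt.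
  - have pi2 : 0 < pi / 2 :> R by rewrite divr_gt0// pi_gt0.
    apply: (@continuous_cvg _ _ _ _ _ _ (fun y => y `^ x)); last exact: cvgy_atan.
    exact: (der_continuous (is_derive1_powR x pi2)).
have [K K0 hK] := @powR_expR_le_wt R 0 1 (lexx 0) ltr01.
apply: (@le_integrable _ _ _ mu _ (@measurable_itv0y R) _ (EFin \o (fun u => K * x^-1 * g u))).
- apply/measurable_EFinP; apply: measurable_continuous_D => u u0.
  by eapply der_continuous; dtac; exact: u0.
- move=> u; rewrite /= in_itv/= andbT => u0; rewrite lee_fin.
  have p1 : 0 <= u `^ (x - 1) * expR (- u) by rewrite mulr_ge0 ?powR_ge0 ?expR_ge0.
  have p2 : 0 <= K * x^-1 * g u by rewrite mulr_ge0 ?g0// mulr_ge0// invr_ge0 ltW.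
  rewrite (ger0_norm p1) (ger0_norm p2).
  have /= := hK _ u0; rewrite powRr0 !mul1r => eK.
  rewrite [leRHS](_ : _ = atan u `^ (x - 1) * (K * wt u)); last first.
    by rewrite /g /wt; field; rewrite !gt_eqF// ltr_pwDl ?sqr_ge0.
  rewrite ler_pM ?powR_ge0 ?expR_ge0//.
  rewrite -(opprB 1 x) !powRN lef_pV2 ?posrE ?powR_gt0 ?atan0_lt//.
  by apply: ge0_ler_powR; rewrite ?nnegrE ?subr_ge0 ?atan_le ?(ltW u0) ?(ltW x1)// ltW// atan0_lt.
- have := integrableZl (@measurable_itv0y R) (K * x^-1) gi.
  by congr (_.-integrable _ _); apply/funext => y /=; rewrite EFinM.
Qed.

Lemma euler_integralD1 x : 0 < x -> euler_integral (x + 1) = x * euler_integral x.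
Proof.
move=> x0; rewrite /euler_integral.
have i1 := integrable_euler x0.
have i2 := integrable_euler (ltr_wpDr ler01 x0).
apply/esym/eqP; rewrite -subr_eq0 -(RintegralZl x (@measurable_itv0y R) i1); apply/eqP.
rewrite -(RintegralB (@measurable_itv0y R)) //; last first.
  have := integrableZl (@measurable_itv0y R) x i1.
  by congr (_.-integrable _ _); apply/funext => y /=; rewrite EFinM.
have dF (u : R) : 0 < u -> is_derive u 1 (fun v : R => v `^ x * expR (- v))
    (x * (u `^ (x - 1) * expR (- u)) - u `^ (x + 1 - 1) * expR (- u)).
  move=> u0; derive_by; first exact: u0.
  by rewrite addrK; ring.
rewrite (Rintegral_FTC dF (a := 0) (b := 0)) ?subr0//.
- by move=> u u0; eapply der_continuous; dtac; exact: u0.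
- have := integrableZl (@measurable_itv0y R) x i1 => /(integrableB (@measurable_itv0y R)) /(_ i2).
  by congr (_.-integrable _ _); apply/funext => y /=; rewrite -EFinM -EFinB.
- apply: (@cvg0_powR_bound _ _ 1 x) => // u u0.
  rewrite mul1r ger0_norm ?mulr_ge0 ?powR_ge0 ?expR_ge0//.
  by rewrite ler_piMr ?powR_ge0// expR_le1 oppr_le0 ltW.
- have [K K0 hK] := powR_expR_le_wt (ltW x0) ltr01.
  apply: (@cvgy_wt_bound _ _ K) => u u0.
  rewrite ger0_norm ?mulr_ge0 ?powR_ge0 ?expR_ge0//.
  by have := hK _ u0; rewrite mul1r.
Qed.

(** Valid at the poles as well, where both sides vanish, because
    the inverse of 0 is 0. *)
Lemma rGamma_rec x : rGamma x = x * rGamma (x + 1).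
Proof.
rewrite /rGamma.
have [x0|x0] := ltP 0 x.
  rewrite !Gamma_gt0E ?addr_gt0// euler_integralD1//.
  by rewrite invfM mulrA divff ?mul1r// gt_eqF.
have [->|xn0] := eqVneq x 0.
  by rewrite mul0r -[X in Gamma X]oppr0; exact: (rGamma_pole R 0).
have xlt : x < 0 by rewrite lt_neqAle xn0.
rewrite /Gamma.
set n := Num.truncn (1 - (x + 1)).
have -> : Num.truncn (1 - x) = n.+1.
  have -> : 1 - x = 1 + (1 - (x + 1)) by ring.
  rewrite truncnD ?truncn1 ?add1n ?natr1// -topredE/=; lra.
rewrite big_ord_recl/= addr0 -natr1 (addrC n%:R) addrA.
under eq_bigr => i _ do rewrite /bump/= natrD addrA.
by rewrite !invfM !invrK mulrCA.
Qed.

End gamma_recurrence.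

(** * Complex Euler integrals and the line Re z = 1 *)

Section gamma_rotated.
Context {R : realType}.
Implicit Types (p m x w t u : R).
Local Notation mu := (@lebesgue_measure R).
Local Notation D := (`]0%R, +oo[%classic : set R).

(** The derivative in [m] of [m ^ (p + 1)] times the
    integral is the integral of a total derivative in [x], hence 0. *)
Lemma Rintegral_scaled_gamma p m : 0 <= p -> 0 < m ->
  \int[mu]_(x in D) (x `^ p * expR (- (m * x))) =
  euler_integral (p + 1) * m `^ (- (p + 1)).
Proof.
move=> p0 m0; set q := p + 1.
have q0 : 0 < q by rewrite /q; lra.
pose y b := \int[mu]_(x in D) (b `^ q * (x `^ p * expR (- (b * x)))).
have yE b : 0 < b -> y b = b `^ q * \int[mu]_(x in D) (x `^ p * expR (- (b * x))).
  by move=> b0; rewrite /y (RintegralZl _ (@measurable_itv0y R))//; exact: integrable_expR_powR.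
have -> : euler_integral q = y 1.
  rewrite yE// powR1 mul1r /euler_integral addrK.
  by apply: eq_Rintegral => x _; rewrite mul1r.
suff -> : y 1 = y m.
  by rewrite yE// mulrAC powRN divff ?mul1r// gt_eqF// powR_gt0.
apply: (@is_derive0_eq _ y 0 (m + 2)); last 2 first.
- by apply/andP; split; lra.
- by apply/andP; split; lra.
move=> a /andP[a0 _].
have a20 : 0 < a / 2 by lra.
have [K1 K10 h1] := powR_expR_le_wt p0 a20.
have [K2 K20 h2] := powR_expR_le_wt (ltW q0) a20.
pose df b x := q * b `^ p * (x `^ p * expR (- (b * x))) -
   b `^ q * (x `^ q * expR (- (b * x))).
pose c := 2 * a.
have dfle b x : a / 2 < b < c -> 0 < x ->
    `|df b x| <= (q * c `^ p * K1 + c `^ q * K2) * wt x.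
  move=> /andP[ab]; rewrite /c => bc x0; have b0 : 0 < b by lra.
  have eb : expR (- (b * x)) <= expR (- (a / 2 * x)).
    by rewrite ler_expR lerN2 ler_wpM2r ?(ltW x0)// ltW.
  have bcp r : 0 <= r -> b `^ r <= (2 * a) `^ r.
    by move=> r0; apply: ge0_ler_powR; rewrite ?nnegrE//; lra.
  rewrite (le_trans (ler_normB _ _))// [leRHS]mulrDl lerD//.
    rewrite ger0_norm ?mulr_ge0 ?powR_ge0 ?expR_ge0 ?(ltW q0)// -[leRHS]mulrA.
    rewrite ler_pM ?mulr_ge0 ?powR_ge0 ?expR_ge0 ?(ltW q0)//.
      by rewrite ler_wpM2l ?(ltW q0)// bcp.
    by apply: le_trans (h1 _ x0); rewrite ler_wpM2l ?powR_ge0.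
  rewrite ger0_norm ?mulr_ge0 ?powR_ge0 ?expR_ge0 ?(ltW q0)// -[leRHS]mulrA.
  rewrite ler_pM ?mulr_ge0 ?powR_ge0 ?expR_ge0 ?(ltW q0) ?bcp ?(ltW q0)//.
  by apply: le_trans (h2 _ x0); rewrite ler_wpM2l ?powR_ge0.
have aI : a / 2 < a < c by rewrite /c; apply/andP; split; lra.
suff <- : \int[mu]_(x in D) df a x = 0.
  apply: (is_derive_Rintegral (f := fun b x => b `^ q * (x `^ p * expR (- (b * x)))) aI).
  - move=> b /andP[ab _]; have b0 : 0 < b by lra.
    have := integrableZl (@measurable_itv0y R) (b `^ q) (integrable_expR_powR p0 b0).
    by congr (_.-integrable _ _); apply/funext => x /=; rewrite EFinM.
  - move=> b x /andP[ab _] x0; have b0 : 0 < b by lra.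
    derive_by; first exact: b0.
    by rewrite /df /q addrK (powRD_gt0 p 1 x0) powRr1 ?(ltW x0)//; ring.
  - exact: dfle.
pose F x := a `^ p * (x `^ q * expR (- (a * x))).
have dF x : 0 < x -> is_derive x 1 F (df a x).
  move=> x0; rewrite /F; derive_by; first exact: x0.
  by rewrite /df /q addrK !powRD_gt0// !powRr1 ?(ltW x0) ?(ltW a0)//; ring.
rewrite (@Rintegral_FTC _ (df a) F 0 0) ?subr0//.
- by move=> x x0; eapply der_continuous; rewrite /df; dtac; exact: x0.
- apply: (integrable_le_wt _ (fun x => dfle _ x aI)).
  apply: measurable_continuous_D => x x0; eapply der_continuous.
  by rewrite /df; dtac; exact: x0.
- apply: (@cvg0_powR_bound _ F (a `^ p) q) => // x x0.
  rewrite ger0_norm ?mulr_ge0 ?powR_ge0 ?expR_ge0// ler_wpM2l ?powR_ge0//.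
  by rewrite ler_piMr ?powR_ge0// expR_le1 oppr_le0 mulr_ge0// ltW.
- apply: (@cvgy_wt_bound _ F (a `^ p * K2)) => x x0.
  rewrite ger0_norm ?mulr_ge0 ?powR_ge0 ?expR_ge0// -mulrA ler_wpM2l ?powR_ge0//.
  apply: le_trans (h2 _ x0); rewrite ler_wpM2l ?powR_ge0//.
  by rewrite ler_expR lerN2 ler_wpM2r ?(ltW x0)//; lra.
Qed.

(** The real part, with phase [w], of
    [Gamma (p + 1) * z ^ (- (p + 1))] for [z = m * exp (- i th)]. Carrying the
    phase as a parameter covers the sine integral too, and lets a
    multiplication by [exp (i th)] be a shift of [w]. *)
Lemma Rintegral_gamma_cos p m th w : 0 <= p -> 0 < m ->
  - (pi / 2) < th < pi / 2 ->
  \int[mu]_(x in D) (x `^ p * expR (- (m * cos th * x)) * cos (m * sin th * x + w))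
  = euler_integral (p + 1) * m `^ (- (p + 1)) * cos ((p + 1) * th + w).
Proof.
move=> p0 m0 thI.
have := rotate_gamma_integral ((p + 1) * th + w) p0 m0 thI.
rewrite addrC addKr => ->.
rewrite (RintegralZr _ (@measurable_itv0y R)) ?Rintegral_scaled_gamma//.
exact: integrable_expR_powR.
Qed.

(** The modulus of [1 + i u], whose argument is [atan u]. *)
Definition rho u := Num.sqrt (1 + u ^+ 2).

Lemma rho_gt0 u : 0 < rho u.
Proof. by rewrite sqrtr_gt0 ltr_pwDl ?sqr_ge0. Qed.

Lemma rho_ge1 u : 1 <= rho u.
Proof. by rewrite -[leLHS]sqrtr1 ler_wsqrtr// lerDl sqr_ge0. Qed.

Lemma sqr_rho u : rho u ^+ 2 = 1 + u ^+ 2.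
Proof. by rewrite sqr_sqrtr// addr_ge0 ?sqr_ge0. Qed.

Lemma rho_cos u : rho u * cos (atan u) = 1.
Proof. by rewrite cos_atan divff// gt_eqF// rho_gt0. Qed.

Lemma rho_sin u : rho u * sin (atan u) = u.
Proof.
have c0 : cos (atan u) != 0.
  by apply/eqP => c0; have := rho_cos u; rewrite c0 mulr0 => /eqP; rewrite eq_sym oner_eq0.
have := atanK u; rewrite /tan => {3}<-.
by rewrite -[in RHS](mulr1 (sin _)) -[in RHS](rho_cos u); field.
Qed.

Lemma is_derive_rho u : is_derive u 1 rho (sin (atan u)).
Proof.
have h : 0 < 1 + u ^+ 2 by rewrite ltr_pwDl ?sqr_ge0.
have d1 : is_derive u 1 (fun v : R => 1 + v * v) (u + u).
  by derive_by; ring.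
have := @der_comp R Num.sqrt _ u _ _ d1 (is_derive1_sqrt (h : 0 < 1 + u * u)).
move=> d; apply: (is_derive_eq d).
have r0 := rho_gt0 u.
have -> : sin (atan u) = u / rho u.
  by apply: (mulfI (lt0r_neq0 r0)); rewrite rho_sin mulrCA divff ?mulr1// gt_eqF.
rewrite -/(rho u); field.
by rewrite gt_eqF//.
Qed.

Lemma rho_powR_le_wt b u : 2 <= b -> rho u `^ (- b) <= wt u.
Proof.
move=> b2; rewrite /wt -sqr_rho -powR_mulrn ?(ltW (rho_gt0 u))// -powRN.
by apply: ler_powR; rewrite ?rho_ge1 ?lerN2.
Qed.

Lemma atan_itv u : - (pi / 2) < atan u < pi / 2.
Proof. by rewrite atan_gtNpi2 atan_ltpi2. Qed.

Lemma Rintegral_gamma_line p u w : 0 <= p ->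
  \int[mu]_(x in D) (x `^ p * expR (- x) * cos (u * x + w))
  = euler_integral (p + 1) * rho u `^ (- (p + 1)) * cos ((p + 1) * atan u + w).
Proof.
move=> p0; rewrite -(Rintegral_gamma_cos _ p0 (rho_gt0 u) (atan_itv u)).
by apply: eq_Rintegral => x _; rewrite rho_cos rho_sin mul1r.
Qed.

End gamma_rotated.

(** * Laplace inversion of the powers *)

Section inversion.
Context {R : realType}.
Implicit Types (a c e p m x y z w t u : R).
Local Notation mu := (@lebesgue_measure R).
Local Notation D := (`]0%R, +oo[%classic : set R).

Lemma Rintegral_expR_cos e c : 0 < e ->
  \int[mu]_(u in D) (expR (- (e * u)) * cos (c * u)) = e * (e ^+ 2 + c ^+ 2)^-1.
Proof.
move=> e0; have s0 : 0 < e ^+ 2 + c ^+ 2 by rewrite ltr_wpDr ?sqr_ge0 ?exprn_gt0.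
pose F u := expR (- (e * u)) * (c * sin (c * u) - e * cos (c * u)) * (e ^+ 2 + c ^+ 2)^-1.
pose f u := expR (- (e * u)) * cos (c * u).
have dF u : is_derive u 1 F (f u).
  by rewrite /F; derive_by; rewrite /f; field; rewrite gt_eqF.
have df u : {for u, continuous f}.
  by eapply der_continuous; rewrite /f; dtac.
rewrite (@Rintegral_FTC _ f F (- (e * (e ^+ 2 + c ^+ 2)^-1)) 0) ?sub0r ?opprK//.
- have := @integrable_expR_cos R 0 e c 0 (lexx 0) e0.
  congr (_.-integrable _ _); apply/funext => x /=.
  by rewrite powRr0 mul1r addr0.
- apply: cvg_at_right_filter.
  rewrite (_ : - _ = F 0); first exact: der_continuous (dF 0).
  by rewrite /F !mulr0 sin0 cos0 oppr0 expR0; field; rewrite gt_eqF.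
- have [K K0 hK] := @powR_expR_le_wt R 0 e (lexx 0) e0.
  apply: (@cvgy_wt_bound _ F (K * (`|c| + e) * (e ^+ 2 + c ^+ 2)^-1)) => u u0.
  have := hK _ u0; rewrite powRr0 mul1r => hu.
  rewrite /F normrM normrM (gtr0_norm (expR_gt0 _)).
  rewrite (@ger0_norm _ (_^-1)) ?invr_ge0 ?(ltW s0)//.
  rewrite [leRHS]mulrAC ler_wpM2r ?invr_ge0 ?(ltW s0)//.
  rewrite [leRHS]mulrAC ler_pM ?expR_ge0//.
  rewrite (le_trans (ler_normB _ _))// lerD// ?norm_mul_sin//.
  by rewrite (le_trans (norm_mul_cos _ _))// gtr0_norm.
Qed.

Lemma integrable_poisson e t : 0 < e ->
  mu.-integrable D (EFin \o (fun x => e * (e ^+ 2 + (x - t) ^+ 2)^-1)).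
Proof.
move=> e0.
have s0 x : 0 < e ^+ 2 + (x - t) ^+ 2 by rewrite ltr_wpDr ?sqr_ge0 ?exprn_gt0.
pose f x := e * (e ^+ 2 + (x - t) ^+ 2)^-1.
have cf x : {for x, continuous f}.
  by eapply der_continuous; rewrite /f; dtac; rewrite gt_eqF// s0.
pose A := 2 + (1 + 2 * t ^+ 2) / e ^+ 2.
apply: (@integrable_le_wt _ f (e * A)).
  by apply: measurable_continuous_D => x _.
move=> x x0; rewrite /f ger0_norm ?mulr_ge0 ?invr_ge0 ?(ltW e0) ?(ltW (s0 _))//.
rewrite -mulrA ler_wpM2l ?(ltW e0)// /wt ler_pdivlMr ?ltr_pwDl ?sqr_ge0//.
rewrite mulrC ler_pdivrMr// /A mulrDl mulrDr.
have h1 : 1 + 2 * t ^+ 2 = (1 + 2 * t ^+ 2) / e ^+ 2 * e ^+ 2.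
  by rewrite mulfVK// sqrf_eq0 gt_eqF.
have h2 : 0 <= (1 + 2 * t ^+ 2) / e ^+ 2 * (x - t) ^+ 2.
  by rewrite mulr_ge0 ?sqr_ge0// divr_ge0 ?sqr_ge0// addr_ge0// mulr_ge0 ?sqr_ge0.
have h3 : 0 <= (x - t *+ 2) ^+ 2 by exact: sqr_ge0.
have h4 : 0 <= e ^+ 2 by exact: sqr_ge0.
rewrite mulrDr -h1; nra.
Qed.

Lemma poisson_mass e t : 0 < e ->
  \int[mu]_(x in D) (e * (e ^+ 2 + (x - t) ^+ 2)^-1) = pi / 2 + atan (t / e).
Proof.
move=> e0.
have s0 x : 0 < e ^+ 2 + (x - t) ^+ 2 by rewrite ltr_wpDr ?sqr_ge0 ?exprn_gt0.
pose F x := atan (e^-1 * (x - t)).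
pose f x := e * (e ^+ 2 + (x - t) ^+ 2)^-1.
have dF x : is_derive x 1 F (f x).
  rewrite /F; derive_by; rewrite /f; field.
  by rewrite !gt_eqF// (_ : _ + _ = e ^+ 2 + (x - t) ^+ 2) ?s0//; ring.
have cf x : {for x, continuous f}.
  by eapply der_continuous; rewrite /f; dtac; rewrite gt_eqF// s0.
have emono : e^-1 * (y - t) @[y --> +oo%R] --> +oo%R.
  apply/cvgryPge => A; near=> z; rewrite ler_pdivlMl// lerBrDr.
  by near: z; apply: nbhs_pinfty_ge; rewrite num_real.
rewrite (@Rintegral_FTC _ f F (- atan (t / e)) (pi / 2)) ?opprK//.
- exact: integrable_poisson.
- apply: cvg_at_right_filter.
  rewrite (_ : - _ = F 0); first exact: der_continuous (dF 0).
  by rewrite /F sub0r mulrN atanN mulrC.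
- exact: (cvg_comp _ (@atan R) emono (@cvgy_atan R)).
Unshelve. all: by end_near. Qed.

(** Laplace inversion of [z ^ (- a)] on the line Re z = 1.
    Damping the integrand by [exp (- e u)] and inserting the Euler integral of
    [z ^ (- a)] turns the left side, by Fubini, into the integral of
    [g x = x ^ (a - 1) * exp (- x)] against the Poisson kernel
    [e / (e ^ 2 + (x - t) ^ 2)], which tends to [pi * g t] as [e] tends to 0. *)
Lemma bromwich_euler a t : 2 <= a -> 0 < t ->
  euler_integral a *
  \int[mu]_(u in D) (expR t * rho u `^ (- a) * cos (t * u - a * atan u)) =
  pi * t `^ (a - 1).
Proof.
move=> a2 t0; pose p := a - 1.
have p1 : 1 <= p by rewrite /p; lra.
have p0 : 0 <= p by lra.
have pE : p + 1 = a by rewrite /p subrK.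
pose G := euler_integral a.
pose g x := x `^ p * expR (- x).
pose e n : R := n.+1%:R^-1.
have e0 n : 0 < e n by rewrite invr_gt0.
have e_cvg : e n @[n --> \oo] --> (0 : R) by exact: cvg_harmonic.
have [M M0 hM] := powR_expR_bounded p0.
have gle x : 0 < x -> `|g x| <= M.
  by move=> x0; rewrite /g ger0_norm ?mulr_ge0 ?powR_ge0 ?expR_ge0// hM.
have [L L0 hL] : exists2 L, 0 <= L & forall x, 0 < x -> `|g x - g t| <= L * `|x - t|.
  have [M' M'0 hM'] : exists2 K, 0 <= K & forall x, 0 < x -> x `^ (p - 1) * expR (- x) <= K.
    by apply: powR_expR_bounded; lra.
  exists (p * M' + M) => [|x x0]; first by rewrite addr_ge0 ?mulr_ge0.
  have dg y : 0 < y -> is_derive y 1 g (p * (y `^ (p - 1) * expR (- y)) - g y).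
    by move=> y0; rewrite /g; derive_by; [exact: y0|ring].
  have dle y : 0 < y -> `|p * (y `^ (p - 1) * expR (- y)) - g y| <= p * M' + M.
    move=> y0; rewrite (le_trans (ler_normB _ _))// lerD ?gle//.
    by rewrite ger0_norm ?mulr_ge0 ?powR_ge0 ?expR_ge0// ler_wpM2l ?hM'.
  have aux y z : 0 < y -> y < z -> `|g z - g y| <= (p * M' + M) * (z - y).
    move=> y0 yz.
    have dI y1 : y1 \in `]y, z[ ->
        is_derive y1 1 g (p * (y1 `^ (p - 1) * expR (- y1)) - g y1).
      by rewrite in_itv/= => /andP[h _]; apply: dg; exact: lt_trans y0 h.
    have [|w] := MVT yz dI.
      apply: continuous_in_subspaceT => r; rewrite inE/= in_itv/= => /andP[yr _].
      exact: der_continuous (dg _ (lt_le_trans y0 yr)).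
    rewrite in_itv/= => /andP[yw _] ->.
    rewrite normrM (@gtr0_norm _ (z - y)) ?subr_gt0//.
    by rewrite ler_wpM2r ?dle ?subr_ge0 ?(ltW yz)// (lt_trans y0).
  have [xt|tx|->] := ltgtP x t; last by rewrite !subrr !normr0 mulr0.
    by rewrite distrC (distrC x) (gtr0_norm (_ : 0 < t - x)) ?subr_gt0// aux.
  by rewrite (@gtr0_norm _ (x - t)) ?subr_gt0// aux.
(* Dominates k n * (g - g t): by the Lipschitz bound when |x - t| <= 1, by the
   bound on g when |x - t| > 1; the factor 3 + 2 t ^ 2 compares (x - t) ^ 2 with 1 + x ^ 2. *)
pose C := (L + 2 * M) * (3 + 2 * t ^+ 2).
pose k n x := e n * (e n ^+ 2 + (x - t) ^+ 2)^-1.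
have sp n x : 0 < e n ^+ 2 + (x - t) ^+ 2 by rewrite ltr_wpDr ?sqr_ge0 ?exprn_gt0.
have mg : measurable_fun D g.
  by apply: measurable_continuous_D => x x0; eapply der_continuous; rewrite /g; dtac; exact: x0.
have mk n : measurable_fun D (k n).
  apply: measurable_continuous_D => x x0; eapply der_continuous.
  by rewrite /k; dtac; rewrite gt_eqF// sp.
have hk n x : 0 < x -> `|k n x * (g x - g t)| <= C * wt x.
  move=> x0; rewrite normrM.
  have k0 : 0 <= k n x by rewrite mulr_ge0 ?invr_ge0 ?(ltW (e0 n)) ?(ltW (sp n x)).
  rewrite (ger0_norm k0) /k /wt.
  have w0 : 0 < 1 + x ^+ 2 by rewrite ltr_pwDl ?sqr_ge0.
  rewrite mulrAC ler_pdivrMr// [leRHS]mulrAC ler_pdivlMr// -/(e n).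
  set d := `|g x - g t|; set S := e n ^+ 2 + (x - t) ^+ 2.
  have d0 : 0 <= d by exact: normr_ge0.
  have d1 : d <= L * `|x - t| by exact: hL.
  have d2 : d <= 2 * M.
    by rewrite (le_trans (ler_normB _ _))// mulr_natl mulr2n lerD// gle.
  have e1 : e n <= 1 by rewrite invf_le1// ler1n.
  have en0 := e0 n.
  have S0 : 0 < S by exact: sp.
  have hx : 1 + x ^+ 2 <= (1 + 2 * t ^+ 2) + 2 * (x - t) ^+ 2.
    by have := sqr_ge0 (x - t *+ 2); nra.
  have T0 : 0 <= 3 + 2 * t ^+ 2 by have := sqr_ge0 t; lra.
  have yE : (x - t) ^+ 2 = `|x - t| ^+ 2 by rewrite real_normK ?num_real.
  have [y1|y1] := leP `|x - t| 1.
    apply: (@le_trans _ _ (L * S * (3 + 2 * t ^+ 2))).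
      apply: ler_pM; rewrite ?mulr_ge0 ?(ltW en0) ?(ltW w0)//.
        apply: (@le_trans _ _ (L * (e n * `|x - t|))).
          by rewrite mulrCA ler_wpM2l ?(ltW en0).
        rewrite ler_wpM2l// /S yE.
        by have := sqr_ge0 (e n - `|x - t|); have := sqr_ge0 (e n + `|x - t|); nra.
      apply: (le_trans hx); rewrite yE.
      by have := normr_ge0 (x - t); nra.
    rewrite /C mulrAC ler_wpM2r ?(ltW S0)// ler_wpM2r// lerDl mulr_ge0//.
  apply: (@le_trans _ _ (2 * M * ((3 + 2 * t ^+ 2) * S))).
    apply: ler_pM; rewrite ?mulr_ge0 ?(ltW en0) ?(ltW w0)//.
      by apply: le_trans d2; rewrite ler_piMl.
    apply: (le_trans hx); rewrite /S yE.
    have q1 : 1 <= `|x - t| ^+ 2 by rewrite expr_ge1// ltW.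
    have h1 : 0 <= t ^+ 2 * (`|x - t| ^+ 2 - 1) by rewrite mulr_ge0 ?sqr_ge0 ?subr_ge0.
    have h2 : 0 <= (3 + 2 * t ^+ 2) * e n ^+ 2 by rewrite mulr_ge0 ?sqr_ge0.
    move: h1 h2; rewrite mulrBr mulr1 mulrDr => h1 h2; lra.
  by rewrite /C mulrA ler_wpM2r ?(ltW S0)// ler_wpM2r// lerDr.
have cvg_k : \int[mu]_(x in D) (k n x * (g x - g t)) @[n --> \oo] --> (0 : R).
  have i0 : \int[mu]_(x in D) (0 : R) = 0 by rewrite /Rintegral integral0.
  rewrite -{2}i0; apply: (@cvg_Rintegral _ _ (fun=> 0) (fun x => C * wt x)).
  - exact: integrable_wtZ.
  - by move=> n; apply: measurable_funM => //; apply: measurable_funB.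
  - exact: hk.
  move=> x x0; have [->|xt] := eqVneq x t.
    by rewrite subrr; under eq_cvg do rewrite mulr0; exact: cvg_cst.
  have y0 : (0 : R) ^+ 2 + (x - t) ^+ 2 != 0.
    by rewrite expr0n add0r sqrf_eq0 subr_eq0.
  have c0 : {for 0, continuous (fun z : R => z * (z ^+ 2 + (x - t) ^+ 2)^-1)}.
    by eapply der_continuous; dtac.
  have := continuous_cvg _ c0 e_cvg; rewrite mul0r => hc.
  by rewrite -[X in _ --> X](mul0r (g x - g t)); apply: cvgM; [exact: hc|exact: cvg_cst].
have cvg_atan : g t * (pi / 2 + atan (t / e n)) @[n --> \oo] --> g t * pi.
  have te : t / e n @[n --> \oo] --> +oo.
    apply/cvgryPge => A; near=> N; rewrite /e invrK -ler_pdivrMl//.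
    rewrite (@le_trans _ _ N%:R)//; last by rewrite ler_nat.
    by near: N; exact: nbhs_infty_ger.
  have ha : atan (t / e n) @[n --> \oo] --> (pi / 2 : R).
    apply: (@cvg_comp _ _ _ (fun n => t / e n) atan _ _ _ te).
    exact: cvgy_atan.
  rewrite [X in g t * X](splitr pi).
  by apply: cvgM; [exact: cvg_cst|apply: cvgD; [exact: cvg_cst|exact: ha]].
have cvg1 : \int[mu]_(x in D) (g x * k n x) @[n --> \oo] --> g t * pi.
  have ik n : mu.-integrable D (EFin \o k n) by exact: integrable_poisson.
  have id n : mu.-integrable D (EFin \o (fun x => k n x * (g x - g t))).
    apply: integrable_le_wt (hk n).
    by apply: measurable_funM => //; apply: measurable_funB.
  have eqn n : \int[mu]_(x in D) (g x * k n x) =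
      \int[mu]_(x in D) (k n x * (g x - g t)) + g t * (pi / 2 + atan (t / e n)).
    rewrite -poisson_mass// -(RintegralZl _ (@measurable_itv0y R)) ?ik//.
    rewrite -(RintegralD (@measurable_itv0y R))//; last first.
      have := integrableZl (@measurable_itv0y R) (g t) (ik n).
      by congr (_.-integrable _ _); apply/funext => y /=; rewrite EFinM.
    by apply: eq_Rintegral => x _; rewrite /k; ring.
  under eq_cvg do rewrite eqn.
  by rewrite -[g t * pi]add0r; apply: cvgD; [exact: cvg_k|exact: cvg_atan].
pose h n u := expR (- (e n * u)) *
   (expR t * rho u `^ (- a) * cos (t * u - a * atan u)).
pose J n := \int[mu]_(u in D) h n u.
have mh n : measurable_fun D (h n).
  apply: measurable_continuous_D => x x0; eapply der_continuous; rewrite /h.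
  by dtac; [exact: rho_gt0|exact: is_derive_rho].
have hh n u : 0 < u -> `|h n u| <= expR t * wt u.
  move=> u0; rewrite /h normrM ger0_norm ?expR_ge0//.
  apply: (@le_trans _ _ `|expR t * rho u `^ (- a) * cos (t * u - a * atan u)|).
    rewrite ler_piMl// expR_le1 oppr_le0 mulr_ge0// ?(ltW u0)//.
    exact: ltW.
  rewrite (le_trans (norm_mul_cos _ _))// ger0_norm ?mulr_ge0 ?powR_ge0 ?expR_ge0//.
  by rewrite ler_wpM2l ?expR_ge0// rho_powR_le_wt.
have ih n : mu.-integrable D (EFin \o h n) by exact: integrable_le_wt (hh n).
have cvg2 : J n @[n --> \oo] -->
    \int[mu]_(u in D) (expR t * rho u `^ (- a) * cos (t * u - a * atan u)).
  apply: (@cvg_Rintegral _ _ _ (fun x => expR t * wt x)) => //.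
  - exact: integrable_wtZ.
  - move=> u u0.
    have c0 : {for 0, continuous (fun z : R => expR (- (z * u)))}.
      by eapply der_continuous; dtac.
    have := continuous_cvg _ c0 e_cvg; rewrite mul0r oppr0 expR0 => hc.
    rewrite -[X in _ --> X]mul1r; apply: cvgM; last exact: cvg_cst.
    exact: hc.
have JE n : G * J n = expR t * \int[mu]_(x in D) (g x * k n x).
  (* The Euler integral at 1 + i u, before integration in either variable. *)
  pose F u x := expR (- (e n * u)) * (x `^ p * expR (- x) * cos (u * x + - (t * u))).
  have E1 : \int[mu]_(u in D) \int[mu]_(x in D) F u x = G * expR (- t) * J n.
    rewrite -(RintegralZl _ (@measurable_itv0y R) (ih n)); apply: eq_Rintegral => u _.
    rewrite /F (RintegralZl _ (@measurable_itv0y R)); last first.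
      have := @integrable_expR_cos R p 1 u (- (t * u)) p0 ltr01.
      by congr (_.-integrable _ _); apply/funext => x /=; rewrite mul1r.
    rewrite Rintegral_gamma_line// pE -/G /h.
    rewrite -[cos (a * _ + _)]cosN opprD opprK (addrC (- _)).
    have et : expR (- t) * expR t = 1 by rewrite -expRD addNr expR0.
    rewrite [RHS](_ : _ = (expR (- t) * expR t) * (expR (- (e n * u)) *
      (G * rho u `^ (- a) * cos (t * u - a * atan u)))); last by ring.
    by rewrite et mul1r.
  have E2 : \int[mu]_(x in D) \int[mu]_(u in D) F u x = \int[mu]_(x in D) (g x * k n x).
    apply: eq_Rintegral => x _; rewrite /k -(Rintegral_expR_cos (x - t) (e0 n)).
    rewrite -(RintegralZl _ (@measurable_itv0y R)); last first.
      have := @integrable_expR_cos R 0 (e n) (x - t) 0 (lexx 0) (e0 n).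
      by congr (_.-integrable _ _); apply/funext => u /=; rewrite powRr0 mul1r addr0.
    apply: eq_Rintegral => u _; rewrite /F /g.
    by rewrite (_ : u * x + - (t * u) = (x - t) * u); ring.
  have mF : measurable_fun setT (fun z : R * R => F z.1 z.2).
    by rewrite /F; mtac.
  rewrite -E2 -(Rintegral_fubini mF (g := fun u => expR (- (e n * u))) (h := g)).
  - have et : expR t * expR (- t) = 1 by rewrite -expRD subrr expR0.
    rewrite E1 [RHS](_ : _ = (expR t * expR (- t)) * (G * J n)); last by ring.
    by rewrite et mul1r.
  - have := @integrable_expR_powR R 0 (e n) (lexx 0) (e0 n).
    by congr (_.-integrable _ _); apply/funext => u /=; rewrite powRr0 mul1r.
  - have := @integrable_expR_powR R p 1 p0 ltr01.
    by congr (_.-integrable _ _); apply/funext => u /=; rewrite mul1r.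
  - by move=> u _; exact: expR_ge0.
  - by move=> x _; rewrite mulr_ge0 ?powR_ge0 ?expR_ge0.
  - move=> u x _ _; rewrite /F mulrA (le_trans (norm_mul_cos _ _))//.
    by rewrite ger0_norm ?mulr_ge0 ?powR_ge0 ?expR_ge0.
have key : G * \int[mu]_(u in D) (expR t * rho u `^ (- a) * cos (t * u - a * atan u))
   = expR t * (g t * pi).
  have h1 : G * J n @[n --> \oo] --> G * \int[mu]_(u in D)
      (expR t * rho u `^ (- a) * cos (t * u - a * atan u)).
    by apply: cvgM; [exact: cvg_cst|exact: cvg2].
  have h2 : G * J n @[n --> \oo] --> expR t * (g t * pi).
    under eq_cvg do rewrite JE.
    by apply: cvgM; [exact: cvg_cst|exact: cvg1].
  exact: cvg_unique h1 h2.
have e1 : expR t * (g t * pi) = pi * t `^ p.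
  rewrite /g mulrC -!mulrA [X in _ * X](_ : _ = pi * (expR (- t) * expR t)); last ring.
  by rewrite -expRD addNr expR0 mulr1 mulrC.
by rewrite -/G key e1.
Unshelve. all: by end_near. Qed.

Lemma euler_neq0 a : 2 <= a -> euler_integral a != 0.
Proof.
move=> a2; apply/eqP => G0; have := bromwich_euler a2 ltr01.
by rewrite G0 mul0r powR1 mulr1 => /esym/eqP; rewrite gt_eqF// pi_gt0.
Qed.

Lemma euler_rGamma a : 2 <= a -> euler_integral a * rGamma a = 1.
Proof.
move=> a2; rewrite /rGamma Gamma_gt0E ?divff ?euler_neq0//.
exact: lt_le_trans a2.
Qed.

Lemma bromwich_gamma a t : 2 <= a -> 0 < t ->
  \int[mu]_(u in D) (expR t * rho u `^ (- a) * cos (t * u - a * atan u)) =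
  pi * (t `^ (a - 1) * rGamma a).
Proof.
move=> a2 t0; apply: (mulfI (euler_neq0 a2)); rewrite bromwich_euler//.
rewrite [RHS](_ : _ = pi * t `^ (a - 1) * (euler_integral a * rGamma a)); last by ring.
by rewrite euler_rGamma// mulr1.
Qed.

End inversion.

(** * The Bromwich integral *)

Section bromwich.
Context {R : realType}.
Implicit Types (al b c p t r u x y N : R).
Local Notation mu := (@lebesgue_measure R).
Local Notation D := (`]0%R, +oo[%classic : set R).

(** The modulus, and with [brom_phase] the argument, of
    [exp (t z - r z ^ al) * z ^ (- b)] at [z = 1 + i u]. *)
Definition brom_amp al b t r u :=
  expR (t - r * (rho u `^ al * cos (al * atan u))) * rho u `^ (- b).

Definition brom_phase al b t r u :=
  t * u - r * (rho u `^ al * sin (al * atan u)) - b * atan u.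

Definition brom al b t r u := brom_amp al b t r u * cos (brom_phase al b t r u).

(** The integral of [exp (t z - r z ^ al) * z ^ (- b)] over the line
    Re z = 1, divided by [2 i pi]. The integrand takes conjugate values at
    conjugate points, so its real part over the upper half of the line
    suffices. *)
Definition phi al b t r := pi^-1 * \int[mu]_(u in D) brom al b t r u.

Lemma brom_amp_ge0 al b t r u : 0 <= brom_amp al b t r u.
Proof. by rewrite mulr_ge0 ?expR_ge0 ?powR_ge0. Qed.

Lemma norm_brom al b t r u : `|brom al b t r u| <= brom_amp al b t r u.
Proof. by rewrite (le_trans (norm_mul_cos _ _))// ger0_norm ?brom_amp_ge0. Qed.

Lemma brom_amp_shift al b t r u c :
  brom_amp al (b - c) t r u = rho u `^ c * brom_amp al b t r u.
Proof. by rewrite /brom_amp opprB addrC powRD_gt0 ?rho_gt0//; ring. Qed.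

Lemma brom_phase_shift al b t r u c :
  brom_phase al (b - c) t r u = brom_phase al b t r u + c * atan u.
Proof. by rewrite /brom_phase; ring. Qed.

Definition min_cos al : R := cos (al * (pi / 2)).

Lemma min_cos_gt0 al : 0 < al < 1 -> 0 < min_cos al.
Proof.
move=> /andP[a0 a1]; have p0 := pi_gt0 R; rewrite /min_cos; apply: cos_gt0_pihalf.
by apply/andP; split; nra.
Qed.

Lemma min_cos_le al u : 0 < al < 1 -> 0 < u -> min_cos al <= cos (al * atan u).
Proof.
move=> /andP[a0 a1] u0; have p0 := pi_gt0 R; apply: le_cos; first by nra.
have at0 : 0 < atan u by rewrite -atan0 lt_atan.
rewrite gtr0_norm ?mulr_gt0//; have /andP[_ h] := atan_itv u.
by rewrite ler_wpM2l ?ltW.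
Qed.

Lemma brom_amp_le_wt al b t r u : 0 < al < 1 -> 2 <= b -> 0 <= r -> 0 < u ->
  brom_amp al b t r u <= expR t * wt u.
Proof.
move=> a01 b2 r0 u0.
rewrite ler_pM ?expR_ge0 ?powR_ge0 ?rho_powR_le_wt// ler_expR gerBl.
rewrite mulr_ge0// mulr_ge0 ?powR_ge0// (le_trans _ (min_cos_le a01 u0))//.
exact/ltW/min_cos_gt0.
Qed.

(** For [al < 1] the real part of [z ^ al] stays above
    [cos (al pi / 2) * |z| ^ al], so the factor [exp (- r z ^ al)] yields decay
    in both [r] and [u], of any polynomial order. *)
Lemma brom_amp_decay al b N : 0 < al < 1 -> 0 <= N -> 2 <= al * N + b ->
  exists2 K, 0 <= K & forall t r u, 0 < r -> 0 < u ->
    brom_amp al b t r u <= expR t * K * r `^ (- N) * wt u.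
Proof.
move=> a01 N0 aNb; have [K K0 hK] := expR_le_powR (min_cos_gt0 a01) N0.
exists K => // t r u r0 u0.
have ra0 : 0 < rho u `^ al by rewrite powR_gt0 ?rho_gt0.
have h : expR (- (r * (rho u `^ al * cos (al * atan u)))) <=
    K * (r `^ (- N) * rho u `^ (- (al * N))).
  apply: (@le_trans _ _ (expR (- (min_cos al * (r * rho u `^ al))))).
    by rewrite ler_expR lerN2 (mulrC (min_cos al)) [leRHS]mulrA ler_wpM2l ?min_cos_le// ltW// mulr_gt0.
  apply: (le_trans (hK _ (mulr_gt0 r0 ra0))).
  rewrite ler_wpM2l// powRM ?(ltW r0) ?(ltW ra0)//.
  by rewrite -powRrM mulrN.
rewrite /brom_amp expRD -!mulrA ler_wpM2l ?expR_ge0//.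
apply: (@le_trans _ _ (K * (r `^ (- N) * rho u `^ (- (al * N))) * rho u `^ (- b))).
  by rewrite ler_wpM2r ?powR_ge0.
rewrite -!mulrA ler_wpM2l// ler_wpM2l ?powR_ge0// -powRD_gt0 ?rho_gt0//.
by rewrite -opprD rho_powR_le_wt.
Qed.

Lemma exists_decay_exponent al b c : 0 < al -> exists2 N, c <= N & 2 <= al * N + b.
Proof.
move=> a0; exists (Num.max c ((2 - b) / al)); first by rewrite le_max lexx.
have : (2 - b) / al <= Num.max c ((2 - b) / al) by rewrite le_max lexx orbT.
by rewrite ler_pdivrMr// => h; rewrite mulrC; lra.
Qed.

Lemma is_derive_brom_r al b t r u :
  is_derive r 1 (fun r => brom al b t r u) (- brom al (b - al) t r u).
Proof.
rewrite /brom brom_amp_shift brom_phase_shift cosD.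
rewrite {1}/brom_amp {1}/brom_phase; derive_by.
by rewrite /brom_amp /brom_phase; ring.
Qed.

Lemma rho_powRN1 u : rho u `^ (-1) = cos (atan u).
Proof. by rewrite powR_inv1 ?ltW ?rho_gt0// cos_atan. Qed.

Lemma cos_atan_sqr u : (1 + u ^+ 2)^-1 = cos (atan u) ^+ 2.
Proof. by rewrite cos_atan exprVn -/(rho u) sqr_rho. Qed.

Lemma is_derive_brom_amp al b t r u :
  is_derive u 1 (brom_amp al b t r) (- brom_amp al b t r u * cos (atan u) *
    (r * al * rho u `^ al * sin (atan u - al * atan u) + b * sin (atan u))).
Proof.
have r0 := rho_gt0 u; have dr := is_derive_rho u.
rewrite /brom_amp; derive_by => //; try eassumption.
have de : 'D_1 rho u = sin (atan u) by exact: derive_val.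
rewrite !(powRD_gt0 _ (-1) r0) rho_powRN1 cos_atan_sqr sinB ?de.
move: (cos (al * _)) (sin (al * _)) (expR _) => cA sA e.
move: (cos _) (sin _) (_ `^ al) (_ `^ (- b)) => c s P Q; ring.
Qed.

Lemma is_derive_brom_phase al b t r u :
  is_derive u 1 (brom_phase al b t r) (t - cos (atan u) *
    (r * al * rho u `^ al * cos (atan u - al * atan u) + b * cos (atan u))).
Proof.
have r0 := rho_gt0 u; have dr := is_derive_rho u.
rewrite /brom_phase; derive_by => //; try eassumption.
have de : 'D_1 rho u = sin (atan u) by exact: derive_val.
rewrite !(powRD_gt0 _ (-1) r0) rho_powRN1 cos_atan_sqr cosB ?de.
move: (cos (al * _)) (sin (al * _)) => cA sA.
move: (cos _) (sin _) (_ `^ al) => c s P; ring.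
Qed.

(** As [dz = i du] on the line, the derivative in [u] of the
    imaginary part of [exp (t z - r z ^ al) * z ^ (- b)] is the real part of
    its derivative in [z]. *)
Lemma is_derive_brom_sin al b t r u :
  is_derive u 1 (fun u => brom_amp al b t r u * sin (brom_phase al b t r u))
    (t * brom al b t r u - al * r * brom al (b + 1 - al) t r u
       - b * brom al (b + 1) t r u).
Proof.
have r0 := rho_gt0 u.
have -> : b + 1 - al = b - (al - 1) by ring.
have -> : b + 1 = b - (-1) by ring.
rewrite /brom !brom_amp_shift !brom_phase_shift mulN1r.
apply: (is_derive_eq (derM (is_derive_brom_amp al b t r u)
  (der_sin (is_derive_brom_phase al b t r u)))).
rewrite (powRD_gt0 _ (-1) r0) rho_powRN1.
have -> : (al - 1) * atan u = - (atan u - al * atan u) by ring.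
move: (brom_amp _ _ _ _ _) (brom_phase _ _ _ _ _) => A X.
move: (atan u - _) => Y; move: (atan u) => y; move: (_ `^ _) => P.
rewrite !cosD !cosN !sinN.
move: (cos X) (sin X) (cos y) (sin y) (cos Y) (sin Y) => cX sX cy sy cY sY.
ring.
Qed.

Lemma measurable_brom al b t r : measurable_fun D (brom al b t r).
Proof.
apply: measurable_continuous_D => u u0; eapply der_continuous.
have r0 := rho_gt0 u; have dr := is_derive_rho u.
by rewrite /brom /brom_amp /brom_phase; dtac => //; eassumption.
Qed.

Lemma continuous_brom al b t r u : {for u, continuous (brom al b t r)}.
Proof.
eapply der_continuous.
have r0 := rho_gt0 u; have dr := is_derive_rho u.
by rewrite /brom /brom_amp /brom_phase; dtac => //; eassumption.
Qed.

Lemma brom_le_wt al b t r u : 0 < al < 1 -> 2 <= b -> 0 <= r -> 0 < u ->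
  `|brom al b t r u| <= expR t * wt u.
Proof. by move=> *; rewrite (le_trans (norm_brom _ _ _ _ _))// brom_amp_le_wt. Qed.

Lemma integrable_brom al b t r : 0 < al < 1 -> 0 < r ->
  mu.-integrable D (EFin \o brom al b t r).
Proof.
move=> a01 r0; have /andP[a0 _] := a01.
have [N N0 hN] := exists_decay_exponent b 0 a0.
have [K K0 hK] := brom_amp_decay a01 N0 hN.
apply: (integrable_le_wt (C := expR t * K * r `^ (- N)) (measurable_brom _ _ _ _)) => u u0.
by rewrite (le_trans (norm_brom _ _ _ _ _))// hK.
Qed.

Lemma phi_decay al b N : 0 < al < 1 -> 0 <= N -> 2 <= al * N + b ->
  exists2 K, 0 <= K & forall t r, 0 < r -> `|phi al b t r| <= expR t * K * r `^ (- N).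
Proof.
move=> a01 N0 aNb; have [K K0 hK] := brom_amp_decay a01 N0 aNb.
exists K => // t r r0; have p0 := pi_gt0 R.
have e0 := expR_gt0 t.
have p1 : 0 <= expR t * K * r `^ (- N) by rewrite !mulr_ge0 ?powR_ge0// ltW.
rewrite /phi normrM ger0_norm ?invr_ge0 ?(ltW p0)// ler_pdivrMl//.
apply: le_trans (le_Rintegral_wt (C := expR t * K * r `^ (- N)) (measurable_brom _ _ _ _) _) _.
  by move=> u u0; rewrite (le_trans (norm_brom _ _ _ _ _))// hK.
by rewrite mulrC ler_wpM2r// ler_pdivrMr//; lra.
Qed.

Lemma phi_bounded al b t r : 0 < al < 1 -> 2 <= b -> 0 < r ->
  `|phi al b t r| <= expR t.
Proof.
move=> a01 b2 r0; have p0 := pi_gt0 R; have e0 := expR_gt0 t.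
rewrite /phi normrM ger0_norm ?invr_ge0 ?(ltW p0)// ler_pdivrMl//.
apply: le_trans (le_Rintegral_wt (C := expR t) (measurable_brom _ _ _ _) _) _.
  by move=> u u0; exact: brom_le_wt (ltW r0) u0.
by rewrite mulrC ler_wpM2r ?(ltW e0)// ler_pdivrMr//; lra.
Qed.

Lemma is_derive_phi al b t r : 0 < al < 1 -> 0 < r ->
  is_derive r 1 (phi al b t) (- phi al (b - al) t r).
Proof.
move=> a01 r0; have /andP[a0 _] := a01.
have [N N0 hN] := exists_decay_exponent (b - al) 0 a0.
have [K K0 hK] := brom_amp_decay a01 N0 hN.
have rI : r / 2 < r < r * 2 by apply/andP; split; lra.
have d : is_derive r 1 (fun r => \int[mu]_(u in D) brom al b t r u)
    (\int[mu]_(u in D) (- brom al (b - al) t r u)).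
  apply: (is_derive_Rintegral (df := fun r u => - brom al (b - al) t r u)
    (C := expR t * K * (r / 2) `^ (- N)) rI).
  - by move=> x /andP[rx _]; apply: integrable_brom => //; lra.
  - by move=> x u _ _; exact: is_derive_brom_r.
  - move=> x u /andP[rx _] u0; have x0 : 0 < x by lra.
    rewrite normrN (le_trans (norm_brom _ _ _ _ _))// (le_trans (hK _ _ _ x0 u0))//.
    rewrite ler_wpM2r ?(ltW (wt_gt0 _))// ler_wpM2l ?mulr_ge0 ?expR_ge0//.
    rewrite !powRN lef_pV2 ?posrE ?powR_gt0//; last by lra.
    by apply: ge0_ler_powR; rewrite ?nnegrE//; lra.
have := derM (der_cst r (pi^-1 : R)) d.
move=> d2; apply: (is_derive_eq d2).
rewrite mul0r add0r /phi -mulrN; congr (_ * _).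
rewrite -mulN1r -(RintegralZl _ (@measurable_itv0y R)) ?integrable_brom//.
by apply: eq_Rintegral => u _; rewrite mulN1r.
Qed.

(** The integral over the line of a total derivative vanishes. The
    relation expresses [phi] at [b] through its values at larger parameters;
    for [b >= 2] the integral converges uniformly down to [r = 0]. *)
Lemma phi_rec al b t r : 0 < al < 1 -> 0 < r ->
  t * phi al b t r = b * phi al (b + 1) t r + al * r * phi al (b + 1 - al) t r.
Proof.
move=> a01 r0; have /andP[a0 _] := a01.
pose F u := brom_amp al b t r u * sin (brom_phase al b t r u).
pose f u := t * brom al b t r u - al * r * brom al (b + 1 - al) t r u
       - b * brom al (b + 1) t r u.
have dF u : is_derive u 1 F (f u) by exact: is_derive_brom_sin.
have iZ c b' : mu.-integrable D (EFin \o (fun u => c * brom al b' t r u)).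
  have := integrableZl (@measurable_itv0y R) c (integrable_brom b' t a01 r0).
  by congr (_.-integrable _ _); apply/funext => y /=; rewrite EFinM.
have i1 : mu.-integrable D (EFin \o (fun u => t * brom al b t r u -
    al * r * brom al (b + 1 - al) t r u)).
  have := integrableB (@measurable_itv0y R) (iZ t b) (iZ (al * r) (b + 1 - al)).
  by congr (_.-integrable _ _); apply/funext => y /=; rewrite EFinB.
have : \int[mu]_(u in D) f u = 0.
  rewrite (@Rintegral_FTC _ f F 0 0) ?subr0//.
  - move=> u u0; apply: continuousB; last first.
      by apply: continuousM; [exact: cvg_cst|exact: continuous_brom].
    apply: continuousB; apply: continuousM; do ?exact: cvg_cst;
      exact: continuous_brom.
  - have := integrableB (@measurable_itv0y R) i1 (iZ b (b + 1)).
    by congr (_.-integrable _ _); apply/funext => y /=; rewrite EFinB.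
  - apply: cvg_at_right_filter; rewrite -[X in _ --> X](_ : F 0 = 0).
      exact: der_continuous (dF 0).
    by rewrite /F /brom_phase atan0 !mulr0 sin0 !mulr0 !subr0 sin0 mulr0.
  - have [N N0 hN] := exists_decay_exponent b 0 a0.
    have [K K0 hK] := brom_amp_decay a01 N0 hN.
    apply: (@cvgy_wt_bound _ F (expR t * K * r `^ (- N))) => u u0.
    by rewrite (le_trans (norm_mul_sin _ _))// ger0_norm ?brom_amp_ge0 ?hK.
rewrite /f (RintegralB (@measurable_itv0y R)) ?iZ//= (RintegralB (@measurable_itv0y R)) ?iZ//=.
rewrite !(RintegralZl _ (@measurable_itv0y R)) ?integrable_brom// => h.
rewrite /phi; move: h.
set I1 := \int[mu]_(x in _) brom al b t r x.
set I2 := \int[mu]_(x in _) brom al (b + 1 - al) t r x.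
set I3 := \int[mu]_(x in _) brom al (b + 1) t r x => h.
have -> : t * (pi^-1 * I1) = pi^-1 * (t * I1 - al * r * I2 - b * I3) +
    (b * (pi^-1 * I3) + al * r * (pi^-1 * I2)) by ring.
by rewrite h mulr0 add0r.
Qed.

Lemma cvg_phi_ge2 al b t : 0 < al < 1 -> 2 <= b -> 0 < t ->
  phi al b t r @[r --> 0^'+] --> t `^ (b - 1) * rGamma b.
Proof.
move=> a01 b2 t0; have p0 := pi_gt0 R.
apply/cvg_at_rightP => v [v0 vc].
have -> : t `^ (b - 1) * rGamma b = pi^-1 * \int[mu]_(u in D) brom al b t 0 u.
  rewrite -[LHS](mulKf (lt0r_neq0 p0)) -(bromwich_gamma b2 t0); congr (_ * _).
  apply: eq_Rintegral => u _.
  by rewrite /brom /brom_amp /brom_phase !mul0r !subr0.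
apply: cvgM; first exact: cvg_cst.
apply: (@cvg_Rintegral _ _ _ (fun u => expR t * wt u)).
- exact: integrable_wtZ.
- by move=> n; exact: measurable_brom.
- by move=> n u u0; apply: brom_le_wt => //; exact/ltW/v0.
- move=> u u0.
  have c0 : {for 0, continuous (fun r => brom al b t r u)}.
    exact: der_continuous (is_derive_brom_r al b t 0 u).
  exact: (continuous_cvg _ c0 vc).
Qed.

End bromwich.

(** * Convergence of Taylor series on the half-line *)

Section taylor.
Context {R : realType}.
Implicit Types (s x y : R).

Lemma der_exprn (f : R -> R) x c n : is_derive x 1 f c ->
  is_derive x 1 (fun y => f y ^+ n.+1) (n.+1%:R * f x ^+ n * c).
Proof.
move=> fc; elim: n => [|n IH].
  by apply: (is_derive_eq fc); rewrite expr0 mulr1 mul1r.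
rewrite (_ : (fun y => _) = fun y => f y * f y ^+ n.+1); last first.
  by apply/funext => y; rewrite exprS.
apply: (is_derive_eq (derM fc IH)).
by rewrite [n.+2%:R]mulrSr !exprS; ring.
Qed.

Lemma ge0_derive_cvg0 (h dh : R -> R) s : 0 < s ->
  (forall x, 0 < x -> is_derive x 1 h (dh x)) ->
  (forall x, 0 < x <= s -> 0 <= dh x) ->
  h x @[x --> 0^'+] --> (0 : R) -> 0 <= h s.
Proof.
move=> s0 hd dh0 h0.
have mono y : 0 < y < s -> h y <= h s.
  move=> /andP[y0 ys].
  have dI x : x \in `]y, s[ -> is_derive x 1 h (dh x).
    by rewrite in_itv/= => /andP[h1 _]; apply: hd; exact: lt_trans y0 h1.
  have [|w] := MVT ys dI.
    apply: continuous_in_subspaceT => r; rewrite inE/= in_itv/= => /andP[yr _].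
    exact: der_continuous (hd _ (lt_le_trans y0 yr)).
  rewrite in_itv/= => /andP[yw ws] hE.
  rewrite -subr_ge0 hE mulr_ge0 ?subr_ge0 ?(ltW ys)// dh0//.
  by rewrite (lt_trans y0 yw) ltW.
apply: (cvgr_to_le h0); near=> y; apply: mono; apply/andP; split; near: y.
  exact: nbhs_right_gt.
exact: nbhs_right_lt.
Unshelve. all: by end_near. Qed.

Definition taylor_sum (a : nat -> R) n k x : R :=
  \sum_(j < n) (- x) ^+ j / j`!%:R * a (k + j)%N.

Lemma taylor_sum0 a n k : taylor_sum a n.+1 k 0 = a k.
Proof.
rewrite /taylor_sum big_ord_recl big1 => [|i _]; last first.
  by rewrite oppr0 expr0n/= !mul0r.
by rewrite expr0 fact0 divr1 mul1r addn0 addr0.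
Qed.

Lemma is_derive_taylor_sum a n k x :
  is_derive x 1 (taylor_sum a n.+1 k) (- taylor_sum a n k.+1 x).
Proof.
elim: n => [|n IH].
  rewrite (_ : taylor_sum a 1 k = fun=> a k); last first.
    apply/funext => y; rewrite /taylor_sum big_ord_recl big_ord0.
    by rewrite expr0 fact0 divr1 mul1r addn0 addr0.
  by rewrite /taylor_sum big_ord0 oppr0; exact: der_cst.
rewrite (_ : taylor_sum a n.+2 k = fun y => taylor_sum a n.+1 k y +
   (- y) ^+ n.+1 * (n.+1`!%:R^-1 * a (k + n.+1)%N)); last first.
  by apply/funext => y; rewrite /taylor_sum big_ord_recr/= mulrA.
apply: (is_derive_eq (derD IH (derM (der_exprn n (derNid x)) (der_cst x _)))).
rewrite mulr0 addr0 /taylor_sum [in RHS]big_ord_recr/= opprD addSnnS; congr (_ + _).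
rewrite factS natrM invfM.
have n0 : n.+1%:R != 0 :> R by rewrite pnatr_eq0.
have f0 : n`!%:R != 0 :> R by rewrite pnatr_eq0 -lt0n fact_gt0.
move: (n.+1%:R) (n`!%:R) n0 f0 => N F n0 f0.
by field; rewrite n0 f0.
Qed.

(** Integration of the estimate for the shifted sequence,
    starting from the limits at 0; the functions are only known for positive
    arguments. *)
Lemma taylor_estimate (f : nat -> R -> R) (a : nat -> R) s n : 0 < s ->
  (forall k x, 0 < x -> is_derive x 1 (f k) (- f k.+1 x)) ->
  (forall k, f k x @[x --> 0^'+] --> a k) ->
  forall k B, (forall x, 0 < x <= s -> `|f (k + n)%N x| <= B) ->
  forall x, 0 < x <= s ->
    `|f k x - taylor_sum a n k x| <= B * x ^+ n / n`!%:R.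
Proof.
move=> s0 df fa; elim: n => [|n IH] k B fB x xs.
  by rewrite /taylor_sum big_ord0 subr0 fact0 divr1 mulr1 -[k]addn0 fB.
have {}IH := IH k.+1 B; rewrite addSnnS in IH; have {}IH := IH fB.
have /andP[x0 xs'] := xs.
pose g y := f k y - taylor_sum a n.+1 k y.
have dg y : 0 < y -> is_derive y 1 g (- (f k.+1 y - taylor_sum a n k.+1 y)).
  move=> y0; apply: (is_derive_eq (derD (df k y y0) (derN (is_derive_taylor_sum a n k y)))).
  by rewrite opprK opprB addrC.
have g0 : g y @[y --> 0^'+] --> (0 : R).
  rewrite -[X in _ --> X](subrr (a k)); apply: cvgB; first exact: fa.
  apply: cvg_at_right_filter; rewrite -[X in _ --> X](taylor_sum0 a n).
  exact: der_continuous (is_derive_taylor_sum a n k 0).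
pose P (y : R) := B * (n.+1`!%:R^-1 * y ^+ n.+1).
have n0 : n.+1%:R != 0 :> R by rewrite pnatr_eq0.
have f0 : n`!%:R != 0 :> R by rewrite pnatr_eq0 -lt0n fact_gt0.
have dP y : is_derive y 1 P (B * y ^+ n / n`!%:R).
  rewrite /P; apply: (is_derive_eq (derM (der_cst y B) (derM (der_cst y _) (der_exprn n (der_id y))))).
  rewrite factS natrM invfM; move: (n.+1%:R) (n`!%:R) n0 f0 => N F n0 f0.
  by field; rewrite n0 f0.
have P0 : P y @[y --> 0^'+] --> (0 : R).
  apply: cvg_at_right_filter; rewrite -[X in _ --> X](_ : P 0 = 0).
    exact: der_continuous (dP 0).
  by rewrite /P expr0n/= !mulr0.
have PE : B * x ^+ n.+1 / n.+1`!%:R = P x by rewrite /P; ring.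
rewrite PE -/(g x) ler_norml; apply/andP; split.
- rewrite -subr_ge0 opprK.
  apply: (@ge0_derive_cvg0 (fun y => g y + P y)
    (fun y => - (f k.+1 y - taylor_sum a n k.+1 y) + B * y ^+ n / n`!%:R)) => //.
  + by move=> y y0; exact: derD (dg _ y0) (dP y).
  + move=> y /andP[y0 yx]; rewrite addrC subr_ge0.
    apply: (le_trans (ler_norm _)); apply: IH.
    by rewrite y0 (le_trans yx).
  + by rewrite -[X in _ --> X]addr0; apply: cvgD.
- rewrite -subr_ge0.
  apply: (@ge0_derive_cvg0 (fun y => P y - g y)
    (fun y => B * y ^+ n / n`!%:R - - (f k.+1 y - taylor_sum a n k.+1 y))) => //.
  + by move=> y y0; exact: derD (dP y) (derN (dg _ y0)).
  + move=> y /andP[y0 yx]; rewrite opprK -[X in _ + X]opprK subr_ge0.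
    apply: (le_trans (ler_norm _)); rewrite normrN; apply: IH.
    by rewrite y0 (le_trans yx).
  + by rewrite -[X in _ --> X]subr0; apply: cvgB.
Qed.

(** A sequence of functions each of which is minus the derivative
    of the preceding one is determined on the half-line by its limits at 0, as
    soon as it grows more slowly than the factorial. It is applied both to
    functions known by their integrals and to closed forms, so it also serves as
    a uniqueness principle. *)
Theorem taylor_cvg (f : nat -> R -> R) (a B : nat -> R) s : 0 < s ->
  (forall k x, 0 < x -> is_derive x 1 (f k) (- f k.+1 x)) ->
  (forall k, f k x @[x --> 0^'+] --> a k) ->
  (forall k x, 0 < x <= s -> `|f k x| <= B k) ->
  B n * s ^+ n / n`!%:R @[n --> \oo] --> (0 : R) ->
  series (fun k => (- s) ^+ k / k`!%:R * a k) n @[n --> \oo] --> f 0%N s.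
Proof.
move=> s0 df fa fB B0.
have h n : `|f 0%N s - series (fun k => (- s) ^+ k / k`!%:R * a k) n| <=
    B n * s ^+ n / n`!%:R.
  have := @taylor_estimate f a s n s0 df fa 0%N (B n).
  rewrite /series/= big_mkord; apply; last by rewrite s0 lexx.
  by move=> x xs; rewrite add0n; exact: fB.
apply/cvgrPdist_le => e e0.
move/cvgrPdist_le: B0 => /(_ _ e0); apply: filterS => n.
rewrite sub0r normrN => hn; apply: (le_trans (h n)).
exact: le_trans (ler_norm _) hn.
Qed.

End taylor.

(** * Growth of the Bromwich integral in its parameters *)

Section wright.
Context {R : realType}.
Implicit Types (al b c p t r u x y s E L N Q : R).
Local Notation mu := (@lebesgue_measure R).
Local Notation D := (`]0%R, +oo[%classic : set R).

Lemma exists_lift_steps al b : al < 1 ->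
  exists j : nat, 2 - j%:R * (1 - al) <= b.
Proof.
move=> a1; have d0 : 0 < 1 - al by rewrite subr_gt0.
exists (Num.truncn ((2 - b) / (1 - al))).+1.
rewrite lerBlDr -lerBlDl -ler_pdivrMr//.
by have [h|h] := leP 0 ((2 - b) / (1 - al));
  [have /andP[_ /ltW] := truncn_itv h | apply: (le_trans (ltW h))].
Qed.

(** For [b >= 2] this is Laplace inversion of [z ^ (- b)]; the
    recurrences of [phi] and of the reciprocal Gamma function then descend to
    every [b], in steps of at least [1 - al]. *)
Lemma cvg_phi al b t : 0 < al < 1 -> 0 < t ->
  phi al b t r @[r --> 0^'+] --> t `^ (b - 1) * rGamma b.
Proof.
move=> a01 t0; have /andP[a0 a1] := a01.
have [j] := exists_lift_steps b a1.
elim: j b => [|j IH] b; first by rewrite mul0r subr0 => b2; exact: cvg_phi_ge2.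
rewrite -(natr1 j) mulrDl mul1r => bj.
have [b2|b2] := leP 2 b; first exact: cvg_phi_ge2.
have h1 : phi al (b + 1) t r @[r --> 0^'+] --> t `^ (b + 1 - 1) * rGamma (b + 1).
  by apply: IH; lra.
have h2 : phi al (b + 1 - al) t r @[r --> 0^'+] -->
    t `^ (b + 1 - al - 1) * rGamma (b + 1 - al).
  by apply: IH; lra.
have -> : t `^ (b - 1) * rGamma b = t^-1 * (b * (t `^ (b + 1 - 1) * rGamma (b + 1)) +
    al * 0 * (t `^ (b + 1 - al - 1) * rGamma (b + 1 - al))).
  rewrite (rGamma_rec b) addrK mulr0 mul0r addr0 (powRD_gt0 _ _ t0).
  by rewrite (powR_inv1 (ltW t0)); ring.
have id0 : al * r @[r --> 0^'+] --> al * 0.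
  by apply: cvgM; [exact: cvg_cst|apply: cvg_at_right_filter; exact: cvg_id].
apply: cvg_trans (_ : t^-1 * (b * phi al (b + 1) t r +
   al * r * phi al (b + 1 - al) t r) @[r --> 0^'+] --> _); last first.
  apply: cvgM; first exact: cvg_cst.
  by apply: cvgD; apply: cvgM => //; exact: cvg_cst.
apply: near_eq_cvg; near=> r.
by rewrite -phi_rec// mulKf// gt_eqF.
Unshelve. all: by end_near. Qed.

(** Descent along [phi_rec] from the range [2 <= b]: a step that
    raises [b] by 1 costs a factor [|b| / t <= N / t], a step that raises it by
    [1 - al] costs [al * s / t]. Both are compensated by the growth of the
    bound once [L] exceeds [2 / t] and [L ^ (1 - al)] exceeds
    [2 * al * s / t]. For [b = b0 - al * n] and [N] of order [n] this is of
    order [n ^ (al * n)], hence negligible against the factorial. *)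
Lemma phi_growth al t s : 0 < al < 1 -> 0 < t -> 0 < s ->
  exists2 L, 1 <= L & forall N b r, 2 <= N -> - N <= b -> 0 < r <= s ->
    `|phi al b t r| <= expR t * (L * N) `^ `|3 - b|.
Proof.
move=> a01 t0 s0; have /andP[a0 a1] := a01.
have d0 : 0 < 1 - al by rewrite subr_gt0.
(* Chosen so that Q ^ (1 - al) = 2 * al * s / t. *)
pose Q := (2 * al * s / t) `^ (1 - al)^-1.
have Q0 : 0 <= Q by exact: powR_ge0.
have t2 : 0 < 2 / t by rewrite divr_gt0.
exists (1 + 2 / t + Q); first by lra.
move=> N b r N2 Nb /andP[r0 rs]; set X := _ * N.
have N0 : 0 < N by lra.
have X1 : 1 <= X by rewrite /X; nra.
have X0 : 0 < X by lra.
have XN : N <= t / 2 * X.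
  have : t / 2 * (2 / t) = 1 by field; rewrite gt_eqF.
  have : 0 <= t / 2 * Q * N by rewrite !mulr_ge0 ?invr_ge0 ?(ltW t0) ?(ltW N0).
  have : 0 <= t / 2 * N by rewrite !mulr_ge0 ?invr_ge0 ?(ltW t0) ?(ltW N0).
  move=> h1 h2 h3; rewrite /X.
  have -> : t / 2 * ((1 + 2 / t + Q) * N) = t / 2 * N + t / 2 * (2 / t) * N + t / 2 * Q * N by ring.
  by rewrite h3; lra.
have XQ : al * s <= t / 2 * X `^ (1 - al).
  have QX : Q <= X by rewrite /X; nra.
  have : Q `^ (1 - al) <= X `^ (1 - al).
    by apply: ge0_ler_powR; rewrite ?nnegrE ?(ltW d0) ?(ltW X0).
  rewrite /Q -powRrM mulVf ?gt_eqF// powRr1; last first.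
    by rewrite !mulr_ge0 ?invr_ge0 ?(ltW t0) ?(ltW a0) ?(ltW s0).
  rewrite -(ler_pM2l (_ : 0 < t / 2)); last by rewrite divr_gt0.
  apply: le_trans.
  by rewrite (_ : t / 2 * (2 * al * s / t) = al * s)//; field; rewrite gt_eqF.
have e0 := expR_gt0 t.
have main b' : - N <= b' -> b' <= 3 -> `|phi al b' t r| <= expR t * X `^ (3 - b').
  have [j] := exists_lift_steps b' a1.
  have base c : 2 <= c -> c <= 3 -> `|phi al c t r| <= expR t * X `^ (3 - c).
    move=> c2 c3; apply: le_trans (phi_bounded _ a01 c2 r0) _.
    rewrite ler_peMr ?(ltW e0)// -[leLHS](powRr0 X).
    by apply: ler_powR => //; lra.
  elim: j b' => [|j IH] c; first by rewrite mul0r subr0 => c2 _; exact: base.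
  rewrite -(natr1 j) mulrDl mul1r => cj Nc c3.
  have [c2|c2] := leP 2 c; first exact: base.
  have h1 : `|phi al (c + 1) t r| <= expR t * X `^ (3 - (c + 1)) by apply: IH; lra.
  have h2 : `|phi al (c + 1 - al) t r| <= expR t * X `^ (3 - (c + 1 - al)).
    by apply: IH; lra.
  rewrite -(ler_pM2l t0) -{1}(gtr0_norm t0) -normrM (phi_rec _ _ a01 r0).
  rewrite (le_trans (ler_normD _ _))// (normrM c) (normrM (al * r)) (normrM al)
    (gtr0_norm a0) (gtr0_norm r0).
  have cN : `|c| <= N by rewrite ler_norml Nc/=; lra.
  have E1 : X `^ (3 - c) = X `^ (3 - (c + 1)) * X.
    by rewrite -[X in _ * X](powRr1 (ltW X0)) -powRD_gt0//; congr (_ `^ _); ring.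
  have E2 : X `^ (3 - c) = X `^ (3 - (c + 1 - al)) * X `^ (1 - al).
    by rewrite -powRD_gt0//; congr (_ `^ _); ring.
  have -> : t * (expR t * X `^ (3 - c)) = t / 2 * (expR t * X `^ (3 - c)) + t / 2 * (expR t * X `^ (3 - c)).
    by field.
  apply: lerD.
    rewrite E1 [leRHS](_ : _ = t / 2 * X * (expR t * X `^ (3 - (c + 1)))); last ring.
    by apply: ler_pM => //; exact: le_trans cN XN.
  rewrite E2 [leRHS](_ : _ = t / 2 * X `^ (1 - al) * (expR t * X `^ (3 - (c + 1 - al)))); last ring.
  apply: ler_pM => //; first by rewrite mulr_ge0 ?(ltW a0) ?(ltW r0).
  by apply: le_trans XQ; rewrite ler_wpM2l ?(ltW a0).
(* The absolute value in the exponent also covers b > 3, where phi is bounded. *)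
have [b3|b3] := leP b 3.
  have b30 : 0 <= 3 - b by lra.
  by rewrite (ger0_norm b30); exact: main.
apply: le_trans (phi_bounded _ a01 _ r0) _; first by lra.
rewrite ler_peMr ?(ltW e0)// -[leLHS](powRr0 X).
by apply: ler_powR.
Qed.

Lemma expn_le_fact n : (0 < n)%N ->
  n%:R ^+ n <= n`!%:R * expR 1 ^+ n :> R.
Proof.
case: n => // n _.
have f0 : 0 < n.+1`!%:R :> R by rewrite ltr0n fact_gt0.
have := expR_ge1Dxn n (ler0n R n.+1).
rewrite -expRM_natr mul1r => h.
by rewrite mulrC -ler_pdivrMr//; apply: le_trans h; lra.
Qed.

(** The numerator is of order [n ^ (al * n)] up to geometric
    factors, the factorial is at least [(n / e) ^ n], and [al < 1]. *)
Lemma superexp_cvg0 al E L s (N0 : nat) : 0 < al < 1 -> 0 <= E -> 1 <= L -> 0 < s ->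
  (L * (n%:R + N0%:R)) `^ (E + al * n%:R) * s ^+ n / n`!%:R @[n --> \oo] --> (0 : R).
Proof.
move=> /andP[a0 a1] E0 L1 s0.
have d0 : 0 < 1 - al by rewrite subr_gt0.
have [K K0 hK] := powR_expR_bounded E0.
have L0 : 0 < 2 * L by lra.
(* Two factors e: one from the factorial, one to absorb n ^ E. *)
pose Q := (2 * L) `^ al * s * expR 1 * expR 1.
have Q0 : 0 < Q by rewrite !mulr_gt0 ?powR_gt0 ?expR_gt0.
have h0 : (2 * L) `^ E * K * 2^-1 ^+ n @[n --> \oo] --> (0 : R).
  rewrite -[X in _ --> X](mulr0 ((2 * L) `^ E * K)).
  by apply: cvgM; [exact: cvg_cst|apply: cvg_expr; rewrite ger0_norm; lra].
apply: (squeeze_cvgr _ (cvg_cst 0) h0); near=> n.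
have n1 : (0 < n)%N by near: n; exact: nbhs_infty_gt.
have nN : (N0 <= n)%N by near: n; exact: nbhs_infty_ge.
have nr0 : 0 < n%:R :> R by rewrite ltr0n.
have f0 : 0 < n`!%:R :> R by rewrite ltr0n fact_gt0.
apply/andP; split.
  by rewrite !mulr_ge0 ?powR_ge0 ?exprn_ge0 ?invr_ge0 ?(ltW s0)// ltW.
have nQ : 2 * Q <= n%:R `^ (1 - al).
  have : ((2 * Q) `^ (1 - al)^-1) <= n%:R by near: n; exact: nbhs_infty_ger.
  move=> h; have : ((2 * Q) `^ (1 - al)^-1) `^ (1 - al) <= n%:R `^ (1 - al).
    by apply: ge0_ler_powR; rewrite ?nnegrE ?powR_ge0 ?(ltW d0).
  by rewrite -powRrM mulVf ?gt_eqF// powRr1//; lra.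
have base : (L * (n%:R + N0%:R)) `^ (E + al * n%:R) <= (2 * L * n%:R) `^ (E + al * n%:R).
  have : N0%:R <= n%:R :> R by rewrite ler_nat.
  move=> h; have L0' : 0 <= L by lra.
  have l1 : 0 <= L * (n%:R + N0%:R) by rewrite mulr_ge0 ?addr_ge0.
  have l2 : 0 <= 2 * L * n%:R by rewrite mulr_ge0 ?(ltW L0).
  have l4 : 0 <= E + al * n%:R by rewrite addr_ge0// mulr_ge0 ?(ltW a0).
  apply: ge0_ler_powR => //.
  rewrite (mulrC 2) -mulrA ler_wpM2l//; lra.
have fact_lb := expn_le_fact n1.
rewrite ler_pdivrMr//.
apply: (@le_trans _ _ ((2 * L * n%:R) `^ (E + al * n%:R) * s ^+ n)).
  by rewrite ler_wpM2r ?exprn_ge0 ?(ltW s0).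
have -> : (2 * L * n%:R) `^ (E + al * n%:R) =
    (2 * L) `^ E * n%:R `^ E * (((2 * L) `^ al * n%:R `^ al) ^+ n).
  rewrite (powRD_gt0 _ _ (mulr_gt0 L0 nr0)) (powRrM _ al) powR_mulrn ?powR_ge0//.
  by rewrite !(powRM _ (ltW L0) (ltW nr0)).
have hn := hK _ nr0.
have e1 : expR (- n%:R) = (expR 1 ^+ n)^-1 :> R.
  by rewrite expRN -expRM_natr mul1r.
move: hn; rewrite e1 ler_pdivrMr ?exprn_gt0 ?expR_gt0// => hn.
have nal : n%:R `^ al * (2 * Q) <= n%:R.
  apply: (@le_trans _ _ (n%:R `^ al * n%:R `^ (1 - al))).
    by rewrite ler_wpM2l ?powR_ge0.
  by rewrite -powRD_gt0// addrC subrK powRr1 ?(ltW nr0).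
have nQ0 : 0 <= n%:R `^ al * (2 * Q).
  by apply: mulr_ge0; [exact: powR_ge0|lra].
have nal' : (n%:R `^ al * (2 * Q)) ^+ n <= n`!%:R * expR 1 ^+ n.
  apply: le_trans fact_lb; apply: lerXn2r => //; rewrite nnegrE//.
have q1 : expR 1 ^+ n != 0 :> R by rewrite expf_neq0// gt_eqF// expR_gt0.
have -> : (2 * L) `^ E * n%:R `^ E * ((2 * L) `^ al * n%:R `^ al) ^+ n * s ^+ n =
  (2 * L) `^ E * n%:R `^ E * ((n%:R `^ al * (2 * Q)) ^+ n / (2 ^+ n * (expR 1 ^+ n * expR 1 ^+ n))).
  rewrite /Q !exprMn.
  have q2 : 2 ^+ n != 0 :> R by rewrite expf_neq0.
  by field; rewrite q1 q2.
have -> : (2 * L) `^ E * K * 2^-1 ^+ n * n`!%:R =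
   (2 * L) `^ E * (K * expR 1 ^+ n) * (n`!%:R * expR 1 ^+ n / (2 ^+ n * (expR 1 ^+ n * expR 1 ^+ n))).
  rewrite exprVn.
  have q2 : 2 ^+ n != 0 :> R by rewrite expf_neq0.
  by field; rewrite q1 q2.
apply: ler_pM.
- by rewrite mulr_ge0 ?powR_ge0.
- apply: divr_ge0; first exact: exprn_ge0.
  by rewrite !mulr_ge0 ?exprn_ge0 ?expR_ge0.
- by rewrite ler_wpM2l ?powR_ge0.
- by rewrite ler_wpM2r// invr_ge0 !mulr_ge0 ?exprn_ge0 ?expR_ge0.
Unshelve. all: by end_near. Qed.

End wright.

(** * The Wright function as a Bromwich integral *)

Section psi_phi.
Context {R : realType}.
Implicit Types (al b c p t r u x y s w m th : R).
Local Notation mu := (@lebesgue_measure R).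
Local Notation D := (`]0%R, +oo[%classic : set R).

(** Taylor expansion of the Bromwich integral in [r]: each derivative
    shifts [b] by [- al], and the limits at 0 are the coefficients of the Wright
    series. In particular the Wright function inherits the decay of [phi] along
    the negative axis. *)
Lemma psi_phi al b t r : 0 < al < 1 -> 0 < t -> 0 < r ->
  psi al b t r = phi al b t r.
Proof.
move=> a01 t0 r0; have /andP[a0 a1] := a01.
pose f k := phi al (b - al * k%:R) t.
pose a k := t `^ (b - al * k%:R - 1) * rGamma (b - al * k%:R).
have [L L1 hL] := phi_growth a01 t0 r0.
(* With N = k + N0, the k-th parameter b - al * k is at least - N. *)
pose N0 := (Num.truncn `|b|).+3.
have bN : `|b| + 2 <= N0%:R.
  have /andP[_ h] := truncn_itv (normr_ge0 b).
  have -> : N0%:R = (Num.truncn `|b|).+1%:R + 2 :> R.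
    by rewrite -natrD addn2.
  by rewrite lerD2r ltW.
pose E := `|3 - b|.
pose B k := expR t * (L * (k%:R + N0%:R)) `^ (E + al * k%:R).
have h : series (fun k => (- r) ^+ k / k`!%:R * a k) n @[n --> \oo] --> f 0%N r.
  apply: (@taylor_cvg _ f a B) => //.
  - move=> k x x0; apply: (is_derive_eq (is_derive_phi _ _ a01 x0)).
    by rewrite /f -natr1 mulrDr mulr1 opprD addrA.
  - by move=> k; exact: cvg_phi.
  - move=> k x xr.
    have k0 : 0 <= k%:R :> R by exact: ler0n.
    have b0 := normr_ge0 b; have bb := ler_norm (- b); rewrite normrN in bb.
    apply: le_trans (hL (k%:R + N0%:R) (b - al * k%:R) x _ _ xr) _; [lra|nra|].
    rewrite /B ler_wpM2l ?expR_ge0//; apply: ler_powR; first by nra.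
    have -> : 3 - (b - al * k%:R) = (3 - b) + al * k%:R by ring.
    rewrite (le_trans (ler_normD _ _))// lerD2l ger0_norm// mulr_ge0//.
    exact: ltW.
  - rewrite -[X in _ --> X](mulr0 (expR t)).
    under eq_cvg do rewrite /B -!mulrA.
    apply: cvgM; first exact: cvg_cst.
    under eq_cvg do rewrite mulrA.
    by apply: superexp_cvg0 => //; exact: normr_ge0.
rewrite {1}/f mulr0 subr0 in h.
have tb : t `^ (b - 1) != 0 by rewrite gt_eqF// powR_gt0.
rewrite /psi /Wright.
have -> : limn (series (fun n => (- (r * t `^ (- al))) ^+ n / n`!%:R *
    rGamma (- al * n%:R + b))) = (t `^ (b - 1))^-1 * phi al b t r.
  apply/cvg_lim => //.
  have -> : series (fun n => (- (r * t `^ (- al))) ^+ n / n`!%:R * rGamma (- al * n%:R + b))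
     = fun n => (t `^ (b - 1))^-1 * series (fun k => (- r) ^+ k / k`!%:R * a k) n.
    apply/funext => n; rewrite /series/= mulr_sumr; apply: eq_bigr => k _.
    rewrite /a (_ : - al * k%:R + b = b - al * k%:R); last by ring.
    rewrite (_ : - (r * t `^ (- al)) = (- r) * t `^ (- al)); last by ring.
    rewrite exprMn (_ : (t `^ (- al)) ^+ k = t `^ (- al * k%:R)); last first.
      by rewrite powRrM powR_mulrn// powR_ge0.
    rewrite (_ : b - al * k%:R - 1 = (b - 1) + - al * k%:R); last by ring.
    rewrite (powRD_gt0 (b - 1) (- al * k%:R) t0).
    have f0 : k`!%:R != 0 :> R by rewrite pnatr_eq0 -lt0n fact_gt0.
    by field; rewrite tb f0.
  by apply: cvgM; [exact: cvg_cst|exact: h].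
by rewrite mulrA divff ?mul1r.
Qed.

Lemma phi_bound_ge0 al b t N : 0 < al < 1 -> 0 < t -> 0 <= N ->
  exists2 K, 0 <= K & forall r, 0 < r -> `|phi al b t r| <= K * r `^ (- N).
Proof.
move=> a01 t0 N0; have /andP[a0 a1] := a01.
have [N' NN' hN'] := exists_decay_exponent b N a0.
have [K1 K10 h1] := phi_decay a01 (le_trans N0 NN') hN'.
have [L L1 h2] := phi_growth a01 t0 ltr01.
pose M := `|b| + 2.
exists (expR t * K1 + expR t * (L * M) `^ `|3 - b|).
  by rewrite addr_ge0 ?mulr_ge0 ?expR_ge0 ?powR_ge0.
move=> r r0; rewrite mulrDl.
have [r1|r1] := leP r 1.
  have h3 : `|phi al b t r| <= expR t * (L * M) `^ `|3 - b|.
    apply: h2; rewrite ?r0//; first by rewrite /M lerDr.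
    by rewrite /M lerNl; have := ler_norm (- b); rewrite normrN; lra.
  (* On r <= 1 the weight r ^ (- N) is at least 1, so boundedness suffices. *)
  rewrite -[leLHS]add0r lerD ?mulr_ge0 ?expR_ge0 ?powR_ge0//.
  apply: (le_trans h3); rewrite ler_peMr ?mulr_ge0 ?expR_ge0 ?powR_ge0//.
  rewrite powRN invf_ge1 ?powR_gt0// -[leRHS](powRr0 r).
  by rewrite ger_powR ?r0.
rewrite -[leLHS]addr0 lerD ?mulr_ge0 ?expR_ge0 ?powR_ge0//.
apply: (le_trans (h1 t r r0)); rewrite ler_wpM2l ?mulr_ge0 ?expR_ge0//.
by apply: ler_powR; rewrite ?lerN2// ltW.
Qed.

End psi_phi.

(** * The complex Laplace transform of the scaled Wright function *)

Section laplace.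
Context {R : realType}.
Implicit Types (ga d b c p t r u x y s w m th N K : R).
Local Notation mu := (@lebesgue_measure R).
Local Notation D := (`]0%R, +oo[%classic : set R).

(** The scaled Wright function in terms of the one-variable function
    [phi ga d 1]; unlike [phi ga d r s] this shows the dependence on [r], both
    for the bounds near 0 and for the derivative. *)
Definition wpsi ga d r s := r `^ (d - 1) * phi ga d 1 (s * r `^ (- ga)).

Lemma psi_wpsi ga d r s : 0 < ga < 1 -> 0 < r -> 0 < s ->
  psi ga d r s = wpsi ga d r s.
Proof.
move=> g01 r0 s0; rewrite /wpsi -psi_phi ?mulr_gt0 ?powR_gt0//.
by rewrite /psi !powR1 mul1r mulr1.
Qed.

Lemma is_derive_wpsi_s ga d r s : 0 < ga < 1 -> 0 < r -> 0 < s ->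
  is_derive s 1 (fun s => wpsi ga d r s) (- wpsi ga (d - ga) r s).
Proof.
move=> g01 r0 s0; have x0 : 0 < s * r `^ (- ga) by rewrite mulr_gt0 ?powR_gt0.
have ds : is_derive s 1 (fun s => s * r `^ (- ga)) (r `^ (- ga)).
  by derive_by; ring.
have := derM (der_cst s (r `^ (d - 1))) (der_comp ds (is_derive_phi d 1 g01 x0)).
move=> h; apply: (is_derive_eq h).
rewrite /wpsi (_ : d - ga - 1 = (d - 1) + - ga); last by ring.
by rewrite (powRD_gt0 (d - 1) (- ga) r0); ring.
Qed.

(** The chain rule leaves a combination of [phi] at [d] and
    [d - ga] that [phi_rec] recognizes as its value at [d - 1]. *)
Lemma is_derive_wpsi_r ga d r s : 0 < ga < 1 -> 0 < r -> 0 < s ->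
  is_derive r 1 (fun r => wpsi ga d r s) (wpsi ga (d - 1) r s).
Proof.
move=> g01 r0 s0; have x0 : 0 < s * r `^ (- ga) by rewrite mulr_gt0 ?powR_gt0.
have dx : is_derive r 1 (fun r => s * r `^ (- ga)) (s * (- ga * r `^ (- ga - 1))).
  by derive_by; [exact: r0|ring].
have dp : is_derive r 1 (fun r => r `^ (d - 1)) ((d - 1) * r `^ (d - 1 - 1)).
  by derive_by; [exact: r0|ring].
apply: (is_derive_eq (derM dp (der_comp dx (is_derive_phi d 1 g01 x0)))).
have := phi_rec (d - 1) 1 g01 x0; rewrite mul1r subrK => E.
rewrite /wpsi E.
rewrite (powRD_gt0 (- ga) (- 1) r0) (powRD_gt0 (d - 1) (- 1) r0).
by ring.
Qed.

Lemma wpsi_bound ga d N : 0 < ga < 1 -> 0 <= N ->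
  exists2 K, 0 <= K & forall r s, 0 < r -> 0 < s ->
    `|wpsi ga d r s| <= K * s `^ (- N) * r `^ (d - 1 + ga * N).
Proof.
move=> g01 N0; have [K K0 hK] := phi_bound_ge0 d g01 ltr01 N0.
exists K => // r s r0 s0.
have x0 : 0 < s * r `^ (- ga) by rewrite mulr_gt0 ?powR_gt0.
rewrite /wpsi normrM (ger0_norm (powR_ge0 _ _)).
apply: (le_trans (ler_wpM2l (powR_ge0 _ _) (hK _ x0))).
rewrite (powRM _ (ltW s0) (powR_ge0 _ _)) -powRrM mulrNN (powRD_gt0 (d - 1) _ r0).
by rewrite le_eqVlt; apply/orP; left; apply/eqP; ring.
Qed.

Lemma wpsi_bound_ge2 ga d r s : 0 < ga < 1 -> 2 <= d -> 0 < r -> 0 < s ->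
  `|wpsi ga d r s| <= expR 1 * r `^ (d - 1).
Proof.
move=> g01 d2 r0 s0; rewrite /wpsi normrM (ger0_norm (powR_ge0 _ _)) mulrC.
by rewrite ler_wpM2r ?powR_ge0// phi_bounded// mulr_gt0// powR_gt0.
Qed.

Lemma exists_positive_exponent ga d c : 0 < ga ->
  exists2 N, 0 <= N & c <= d - 1 + ga * N.
Proof.
move=> g0; have [N N0 h] := exists_decay_exponent (d + 1 - c) 0 g0.
by exists N => //; lra.
Qed.

(** The real part of [exp (i w - v r)] with
    [v = m * exp (- i th)]. *)
Definition lap_kernel m th w r := expR (- (m * cos th * r)) * cos (m * sin th * r + w).

Lemma lap_kernel_bound m th w r : `|lap_kernel m th w r| <= expR (- (m * cos th * r)).
Proof. by rewrite (le_trans (norm_mul_cos _ _))// ger0_norm// expR_ge0. Qed.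

Lemma is_derive_lap_kernel m th w r :
  is_derive r 1 (lap_kernel m th w) (- m * lap_kernel m th (w - th) r).
Proof.
rewrite /lap_kernel; derive_by.
by rewrite addrA cosB; ring.
Qed.

Lemma lap_dominated ga d m th s0 : 0 < ga < 1 -> 0 < m -> 0 < cos th -> 0 < s0 ->
  exists2 K, 0 <= K & forall w r s, 0 < r -> s0 <= s ->
   `|lap_kernel m th w r * wpsi ga d r s| <= K * wt r.
Proof.
move=> g01 m0 c0 s00; have /andP[g0 _] := g01.
have [N N0 hN] := exists_positive_exponent d 0 g0.
have [K1 K10 h1] := wpsi_bound d g01 N0.
have [K2 K20 h2] := powR_expR_le_wt hN (mulr_gt0 m0 c0).
exists (K1 * s0 `^ (- N) * K2); first by rewrite !mulr_ge0 ?powR_ge0.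
move=> w r s r0 s0s; have sp : 0 < s by exact: lt_le_trans s0s.
rewrite normrM mulrC.
apply: (@le_trans _ _ (K1 * s0 `^ (- N) * (r `^ (d - 1 + ga * N) * expR (- (m * cos th * r))))).
  rewrite mulrA ler_pM ?lap_kernel_bound//.
  apply: (le_trans (h1 _ _ r0 sp)); rewrite ler_wpM2r ?powR_ge0// ler_wpM2l//.
  rewrite !powRN lef_pV2 ?posrE ?powR_gt0//.
  by apply: ge0_ler_powR; rewrite ?nnegrE ?(ltW sp) ?(ltW s00).
by rewrite -[leRHS]mulrA ler_wpM2l ?mulr_ge0 ?powR_ge0// h2.
Qed.

Lemma continuous_wpsi_r ga d r s : 0 < ga < 1 -> 0 < r -> 0 < s ->
  {for r, continuous (fun r => wpsi ga d r s)}.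
Proof. by move=> *; apply: der_continuous; exact: is_derive_wpsi_r. Qed.

Lemma measurable_lap ga d m th w s : 0 < ga < 1 -> 0 < s ->
  measurable_fun D (fun r => lap_kernel m th w r * wpsi ga d r s).
Proof.
move=> g01 s0; apply: measurable_continuous_D => r r0.
apply: continuousM; last exact: continuous_wpsi_r.
exact: der_continuous (is_derive_lap_kernel m th w r).
Qed.

Lemma integrable_lap ga d m th w s : 0 < ga < 1 -> 0 < m -> 0 < cos th -> 0 < s ->
  mu.-integrable D (EFin \o (fun r => lap_kernel m th w r * wpsi ga d r s)).
Proof.
move=> g01 m0 c0 s0; have [K K0 hK] := lap_dominated d g01 m0 c0 s0.
apply: (integrable_le_wt (C := K) (measurable_lap _ _ _ _ g01 s0)) => r r0.
by apply: hK.
Qed.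

Definition lap ga d m th w s :=
  \int[mu]_(r in D) (lap_kernel m th w r * wpsi ga d r s).

Lemma is_derive_lap ga d m th w s : 0 < ga < 1 -> 0 < m -> 0 < cos th -> 0 < s ->
  is_derive s 1 (lap ga d m th w) (- lap ga (d - ga) m th w s).
Proof.
move=> g01 m0 c0 s0; have s20 : 0 < s / 2 by rewrite divr_gt0.
have [K K0 hK] := lap_dominated (d - ga) g01 m0 c0 s20.
have sI : s / 2 < s < s * 2 by apply/andP; split; lra.
rewrite /lap; apply: (is_derive_eq (is_derive_Rintegral
  (f := fun s r => lap_kernel m th w r * wpsi ga d r s)
  (df := fun s r => - (lap_kernel m th w r * wpsi ga (d - ga) r s)) (C := K) sI _ _ _)).
- by move=> x /andP[xs _]; apply: integrable_lap => //; lra.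
- move=> x r /andP[xs _] r0; have x0 : 0 < x by lra.
  apply: (is_derive_eq (derM (der_cst x _) (is_derive_wpsi_s d g01 r0 x0))).
  by ring.
- by move=> x r /andP[xs _] r0; rewrite normrN hK// ltW.
- rewrite -[RHS]mulN1r /lap -(RintegralZl _ (@measurable_itv0y R)) ?integrable_lap//.
  by apply: eq_Rintegral => r _; rewrite mulN1r.
Qed.

(** Integration by parts in [r]: multiplication by the Laplace
    variable lowers [d] by 1. *)
Lemma lap_shift ga d m th w s : 0 < ga < 1 -> 0 < m -> 0 < cos th -> 0 < s ->
  lap ga (d - 1) m th w s = m * lap ga d m th (w - th) s.
Proof.
move=> g01 m0 c0 s0; have /andP[g0 _] := g01.
pose F r := lap_kernel m th w r * wpsi ga d r s.
pose f r := lap_kernel m th w r * wpsi ga (d - 1) r s -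
  m * (lap_kernel m th (w - th) r * wpsi ga d r s).
have dF r : 0 < r -> is_derive r 1 F (f r).
  move=> r0; apply: (is_derive_eq (derM (is_derive_lap_kernel m th w r)
    (is_derive_wpsi_r d g01 r0 s0))).
  by rewrite /f; ring.
have iZ : mu.-integrable D (EFin \o (fun r => m * (lap_kernel m th (w - th) r * wpsi ga d r s))).
  have := integrableZl (@measurable_itv0y R) m (integrable_lap d (w - th) g01 m0 c0 s0).
  by congr (_.-integrable _ _); apply/funext => y /=; rewrite EFinM.
have : \int[mu]_(r in D) f r = 0.
  rewrite (@Rintegral_FTC _ f F 0 0) ?subr0//.
  - move=> r r0; apply: continuousB.
      apply: continuousM; last exact: continuous_wpsi_r.
      exact: der_continuous (is_derive_lap_kernel m th w r).
    apply: continuousM; first exact: cvg_cst.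
    apply: continuousM; last exact: continuous_wpsi_r.
    exact: der_continuous (is_derive_lap_kernel m th (w - th) r).
  - have := integrableB (@measurable_itv0y R) (integrable_lap (d - 1) w g01 m0 c0 s0) iZ.
    by congr (_.-integrable _ _); apply/funext => y /=; rewrite EFinB.
  - have [N N0 hN] := exists_positive_exponent d 1 g0.
    have [K K0 hK] := wpsi_bound d g01 N0.
    apply: (@cvg0_powR_bound _ F (K * s `^ (- N)) (d - 1 + ga * N)); first by lra.
    move=> r r0; rewrite /F normrM -[leRHS]mul1r ler_pM ?hK//.
    apply: (le_trans (lap_kernel_bound _ _ _ _)).
    by rewrite expR_le1 oppr_le0 !mulr_ge0 ?ltW.
  - have [K K0 hK] := lap_dominated d g01 m0 c0 s0.
    by apply: (@cvgy_wt_bound _ F K) => r r0; exact: hK.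
rewrite /f (RintegralB (@measurable_itv0y R)) ?integrable_lap//.
by rewrite (RintegralZl _ (@measurable_itv0y R)) ?integrable_lap// => /eqP; rewrite subr_eq0 => /eqP.
Qed.

Lemma lap_shiftn ga d m th w s n : 0 < ga < 1 -> 0 < m -> 0 < cos th -> 0 < s ->
  lap ga d m th w s = m ^+ n * lap ga (d + n%:R) m th (w - n%:R * th) s.
Proof.
move=> g01 m0 c0 s0; elim: n => [|n IH].
  by rewrite expr0 mul1r addr0 mul0r subr0.
rewrite {}IH exprSr -mulrA; congr (_ * _).
rewrite (_ : w - n.+1%:R * th = w - n%:R * th - th); last by rewrite -natr1; ring.
have -> : d + n%:R = d + n.+1%:R - 1 by rewrite -natr1; ring.
exact: lap_shift.
Qed.

Lemma cvg_lap_ge2 ga d m th w : 0 < ga < 1 -> 2 <= d -> 0 < m ->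
  - (pi / 2) < th < pi / 2 ->
  lap ga d m th w s @[s --> 0^'+] --> m `^ (- d) * cos (d * th + w).
Proof.
move=> g01 d2 m0 thI; have c0 : 0 < cos th by exact: cos_gt0_pihalf.
have mc : 0 < m * cos th by rewrite mulr_gt0.
have d1 : 0 <= d - 1 by lra.
apply/cvg_at_rightP => v [v0 vc].
have -> : m `^ (- d) * cos (d * th + w) =
    \int[mu]_(r in D) (lap_kernel m th w r * (r `^ (d - 1) * rGamma d)).
  have := Rintegral_gamma_cos w d1 m0 thI; rewrite subrK => E.
  have -> : m `^ (- d) * cos (d * th + w) =
      rGamma d * (euler_integral d * m `^ (- d) * cos (d * th + w)).
    rewrite [RHS](_ : _ = (euler_integral d * rGamma d) * (m `^ (- d) * cos (d * th + w))).
      by rewrite euler_rGamma// mul1r.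
    by ring.
  rewrite -E -(RintegralZl _ (@measurable_itv0y R)) ?integrable_expR_cos//.
  by apply: eq_Rintegral => r _; rewrite /lap_kernel /=; ring.
have [K K0 hK] := powR_expR_le_wt d1 mc.
apply: (@cvg_Rintegral _ _ _ (fun r => expR 1 * K * wt r)).
- exact: integrable_wtZ.
- by move=> n; exact: measurable_lap.
- move=> n r r0; rewrite normrM mulrC.
  apply: (@le_trans _ _ (expR 1 * (r `^ (d - 1) * expR (- (m * cos th * r))))).
    by rewrite mulrA ler_pM ?lap_kernel_bound ?wpsi_bound_ge2.
  by rewrite -[leRHS]mulrA ler_wpM2l ?expR_ge0 ?hK.
- move=> r r0; apply: cvgM; first exact: cvg_cst.
  apply: cvgM; first exact: cvg_cst.
  have := @cvg_phi R ga d 1 g01 ltr01; rewrite powR1 mul1r => /cvg_at_rightP; apply.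
  split; first by move=> n; rewrite mulr_gt0 ?powR_gt0.
  by rewrite -[X in _ --> X](mul0r (r `^ (- ga))); apply: cvgM; [exact: vc|exact: cvg_cst].
Qed.

(** As [s] tends to 0, [psi ga d r s] tends to
    [r ^ (d - 1) / Gamma d], whose Laplace transform is the power [- d] of the
    variable. [lap_shiftn] reduces to [d >= 2], where the convergence is
    dominated. *)
Lemma cvg_lap ga d m th w : 0 < ga < 1 -> 0 < m -> - (pi / 2) < th < pi / 2 ->
  lap ga d m th w s @[s --> 0^'+] --> m `^ (- d) * cos (d * th + w).
Proof.
move=> g01 m0 thI; have c0 : 0 < cos th by exact: cos_gt0_pihalf.
pose n := (Num.truncn `|2 - d|).+1.
have dn : 2 <= d + n%:R.
  have /andP[_ h] := truncn_itv (normr_ge0 (2 - d)).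
  have := ler_norm (2 - d); rewrite -/n in h; lra.
move: n dn => n dn.
have h := @cvg_lap_ge2 ga (d + n%:R) m th (w - n%:R * th) g01 dn m0 thI.
have -> : m `^ (- d) * cos (d * th + w) =
    m ^+ n * (m `^ (- (d + n%:R)) * cos ((d + n%:R) * th + (w - n%:R * th))).
  have e1 : - d = n%:R + - (d + n%:R) by ring.
  have e2 : d * th + w = (d + n%:R) * th + (w - n%:R * th) by ring.
  by rewrite {1}e1 {1}e2 (powRD_gt0 _ _ m0) powR_mulrn ?(ltW m0)// mulrA.
apply: cvg_trans (_ : m ^+ n * lap ga (d + n%:R) m th (w - n%:R * th) s
   @[s --> 0^'+] --> _); last by apply: cvgM; [exact: cvg_cst|exact: h].
apply: near_eq_cvg; near=> s.
by rewrite -lap_shiftn.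
Unshelve. all: by end_near. Qed.

Lemma lap_bounded ga m th c : 0 < ga < 1 -> 0 < m -> 0 < cos th ->
  exists2 K, 0 <= K & forall d w s, 2 <= d <= c -> 0 < s -> `|lap ga d m th w s| <= K.
Proof.
move=> g01 m0 c0; have mc : 0 < m * cos th by rewrite mulr_gt0.
have [K1 K10 h1] := powR_expR_le_wt ler01 mc.
have [K2 K20 h2] := powR_expR_le_wt (normr_ge0 c) mc.
have e0 := expR_gt0 (1 : R); have p0 := pi_gt0 R.
exists (expR 1 * (K1 + K2) * (pi / 2)).
  by apply: mulr_ge0; [apply: mulr_ge0; [exact: ltW|exact: addr_ge0]|lra].
move=> d w s /andP[d2 dc] s0; apply: le_Rintegral_wt; first exact: measurable_lap.
move=> r r0; rewrite normrM mulrC.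
apply: (@le_trans _ _ (expR 1 * r `^ (d - 1) * expR (- (m * cos th * r)))).
  by rewrite ler_pM ?lap_kernel_bound ?wpsi_bound_ge2.
rewrite -[leLHS]mulrA -[leRHS]mulrA ler_wpM2l ?(ltW e0)// mulrDl.
apply: (@le_trans _ _ ((r `^ 1 + r `^ `|c|) * expR (- (m * cos th * r)))); last first.
  by rewrite mulrDl lerD ?h1 ?h2.
rewrite ler_wpM2r ?expR_ge0//.
have [r1|r1] := leP r 1.
  rewrite -[leLHS]addr0 lerD ?powR_ge0//.
  by apply: ger_powR; [rewrite r0 r1|lra].
rewrite -[leLHS]add0r lerD ?powR_ge0//.
apply: ler_powR; first exact: ltW.
by have := ler_norm c; lra.
Qed.

Lemma cvg_geometric_fact C M : C * M ^+ n / n`!%:R @[n --> \oo] --> (0 : R).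
Proof.
rewrite -[X in _ --> X](mulr0 C); under eq_cvg do rewrite -mulrA.
apply: cvgM; first exact: cvg_cst.
exact: cvg_series_cvg_0 (is_cvg_series_exp_coeff M).
Qed.

(** The Laplace transform of [psi ga d r s] in [r] is
    [v ^ (- d) * exp (- s * v ^ ga)] at [v = m * exp (- i th)]. Both sides are
    expanded in powers of [s]: a derivative shifts [d] by [- ga], the limits at
    0 agree by [cvg_lap], and repeated use of [lap_shift] keeps [d] in a bounded
    range at the cost of a geometric factor. *)
Theorem lapE ga d m th w s : 0 < ga < 1 -> 0 < m -> - (pi / 2) < th < pi / 2 -> 0 < s ->
  lap ga d m th w s = m `^ (- d) * expR (- (s * (m `^ ga * cos (ga * th)))) *
    cos (s * (m `^ ga * sin (ga * th)) + (d * th + w)).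
Proof.
move=> g01 m0 thI s0; have c0 : 0 < cos th by exact: cos_gt0_pihalf.
have /andP[g0 g1] := g01.
pose a k := m `^ (- (d - ga * k%:R)) * cos ((d - ga * k%:R) * th + w).
pose f (k : nat) s := lap ga (d - ga * k%:R) m th w s.
pose g (k : nat) s := m `^ (- (d - ga * k%:R)) * expR (- (s * (m `^ ga * cos (ga * th)))) *
    cos (s * (m `^ ga * sin (ga * th)) + ((d - ga * k%:R) * th + w)).
have hf : series (fun k => (- s) ^+ k / k`!%:R * a k) n @[n --> \oo] --> f 0%N s.
  have [K K0 hK] := lap_bounded (`|d| + 3) g01 m0 c0.
  pose M := 1 + m.
  have M1 : 1 <= M by rewrite /M; lra.
  pose J := (Num.truncn (`|d| + 3)).+1.
  have dJ : `|d| + 3 <= J%:R.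
    by have /andP[_ /ltW] : _ := truncn_itv (addr_ge0 (normr_ge0 d) (ler0n R 3)).
  apply: (@taylor_cvg _ f a (fun k => K * M ^+ J * M ^+ k)) => //.
  - move=> k x x0; apply: (is_derive_eq (is_derive_lap (d - ga * k%:R) w g01 m0 c0 x0)).
    by rewrite /f -natr1 mulrDr mulr1 opprD addrA.
  - by move=> k; exact: cvg_lap.
  - move=> k x /andP[x0 _]; rewrite /f.
    set d' := d - ga * k%:R.
    have k0 : 0 <= k%:R :> R by exact: ler0n.
    have gk : 0 <= ga * k%:R <= k%:R by rewrite mulr_ge0 ?(ltW g0)// ler_piMl// ltW.
    have dd := ler_norm d; have nd := ler_norm (- d); rewrite normrN in nd.
    (* Lift d' into [2, |d| + 3], in at most J + k steps, where the transform is
       bounded uniformly. *)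
    have [j jk dj] : exists2 j : nat, (j <= J + k)%N & 2 <= d' + j%:R <= `|d| + 3.
      have [h|h] := leP 2 d'.
        by exists 0%N => //; rewrite addr0 h /= /d'; lra.
      have h' : 0 <= 2 - d' by lra.
      have /andP[t1 t2] := truncn_itv h'.
      exists (Num.truncn (2 - d')).+1.
        rewrite -(ler_nat R) natrD -natr1; rewrite /d' in t1 *; lra.
      rewrite -natr1 in t2 *; apply/andP; split; first lra.
      by have := normr_ge0 d; lra.
    rewrite (lap_shiftn _ w j g01 m0 c0 x0) normrM mulrC -mulrA.
    rewrite ler_pM ?hK// normrX gtr0_norm// -exprD.
    apply: (@le_trans _ _ (M ^+ j)); last exact: ler_weXn2l.
    by apply: lerXn2r; rewrite ?nnegrE /M; lra.
  - by under eq_cvg do rewrite -(mulrA (K * M ^+ J)) -exprMn; exact: cvg_geometric_fact.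
have hg : series (fun k => (- s) ^+ k / k`!%:R * a k) n @[n --> \oo] --> g 0%N s.
  pose C := m `^ (- d) * expR (s * m `^ ga).
  have dg k x : is_derive x 1 (g k) (- g k.+1 x).
    rewrite /g; derive_by.
    rewrite (_ : d - ga * k.+1%:R = (d - ga * k%:R) - ga); last first.
      by rewrite -(natr1 k); ring.
    move: (d - ga * k%:R) => e.
    rewrite (_ : - (e - ga) = - e + ga); last by ring.
    rewrite (powRD_gt0 _ ga m0).
    rewrite (_ : x * (m `^ ga * sin (ga * th)) + ((e - ga) * th + w) =
      x * (m `^ ga * sin (ga * th)) + (e * th + w) - ga * th); last by ring.
    rewrite cosB; ring.
  apply: (@taylor_cvg _ g a (fun k => C * (m `^ ga) ^+ k)) => //.
  - move=> k; apply: cvg_at_right_filter; rewrite -[X in _ --> X](_ : g k 0 = a k).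
      exact: der_continuous (dg k 0).
    by rewrite /g /a !mul0r oppr0 expR0 mulr1 add0r.
  - move=> k x /andP[x0 xs]; rewrite /g (le_trans (norm_mul_cos _ _))//.
    rewrite ger0_norm ?mulr_ge0 ?powR_ge0 ?expR_ge0//.
    rewrite (_ : - (d - ga * k%:R) = - d + ga * k%:R); last by ring.
    rewrite (powRD_gt0 _ _ m0) powRrM powR_mulrn ?powR_ge0//.
    rewrite /C mulrAC ler_wpM2r ?exprn_ge0 ?powR_ge0// ler_wpM2l ?powR_ge0//.
    rewrite ler_expR.
    apply: (@le_trans _ _ (x * m `^ ga)); last by rewrite ler_wpM2r ?powR_ge0.
    rewrite -mulrN ler_wpM2l ?(ltW x0)//.
    apply: (le_trans (ler_norm _)); rewrite normrN.
    by rewrite (le_trans (norm_mul_cos _ _))// ger0_norm ?powR_ge0.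
  - by under eq_cvg do rewrite -(mulrA C) -exprMn; exact: cvg_geometric_fact.
have := cvg_unique _ hf hg; rewrite /f /g mulr0 subr0; apply.
exact: norm_hausdorff.
Qed.

End laplace.

(** * Composition *)

Section composition.
Context {R : realType}.
Implicit Types (al ga d b c p t r u x y s w m th N K : R).
Local Notation mu := (@lebesgue_measure R).
Local Notation D := (`]0%R, +oo[%classic : set R).

(** Near 0 the rapid decay of [psi ga d r s] absorbs the
    negative power; at infinity [psi ga d r s] is of order [r ^ (d - 1)] only,
    and the weight [r ^ (- N)], which comes from the decay of [phi], does the
    work. *)
Lemma wpsi_weighted_bound ga d s N : 0 < ga < 1 -> 0 < s -> 0 <= N -> d + 1 <= N ->
  exists2 K, 0 <= K & forall r, 0 < r -> r `^ (- N) * `|wpsi ga d r s| <= K * wt r.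
Proof.
move=> g01 s0 N0 dN; have /andP[g0 _] := g01.
have [M M0 hM] := exists_positive_exponent d N g0.
have [K1 K10 h1] := wpsi_bound d g01 M0.
have [K2 K20 h2] := wpsi_bound d g01 (lexx 0).
have p1 : 0 <= K1 * s `^ (- M) by rewrite mulr_ge0 ?powR_ge0.
exists (2 * (K1 * s `^ (- M)) + 2 * K2); first by lra.
move=> r r0; have w0 := wt_gt0 r.
have r20 : 0 < 1 + r ^+ 2 by rewrite ltr_pwDl ?sqr_ge0.
have [r1|r1] := leP r 1.
  have w2 : 1 <= 2 * wt r.
    rewrite /wt ler_pdivlMr// mul1r; have : r ^+ 2 <= 1 by rewrite expr_le1// ltW.
    by lra.
  have h3 : r `^ (- N) * `|wpsi ga d r s| <= K1 * s `^ (- M).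
    apply: (le_trans (ler_wpM2l (powR_ge0 _ _) (h1 _ _ r0 s0))).
    rewrite mulrCA -powRD_gt0// ler_piMr//.
    rewrite -[leRHS](powRr0 r); apply: ger_powR; first by rewrite r0.
    by lra.
  by apply: (le_trans h3); nra.
have w2 : r `^ (- 2) <= 2 * wt r.
  rewrite /wt powRN powR_mulrn ?(ltW r0)// -lef_pV2 ?posrE ?invr_gt0 ?mulr_gt0//.
  rewrite invfM !invrK ?exprn_gt0//.
  have : 1 <= r ^+ 2 by rewrite expr_ge1// ltW.
  by lra.
have h3 : r `^ (- N) * `|wpsi ga d r s| <= K2 * r `^ (- 2).
  apply: (le_trans (ler_wpM2l (powR_ge0 _ _) (h2 _ _ r0 s0))).
  rewrite oppr0 powRr0 mulr1 mulr0 addr0 mulrCA ler_wpM2l// -powRD_gt0//.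
  by apply: ler_powR; [exact: ltW|lra].
apply: (le_trans h3); nra.
Qed.

Lemma continuous_rho : continuous (@rho R).
Proof. by move=> u; apply: der_continuous; exact: is_derive_rho. Qed.

Lemma measurable_brom2 al b t :
  measurable_fun setT (fun z : R * R => brom al b t z.1 z.2).
Proof.
have mr : measurable_fun setT (fun z : R * R => rho z.2).
  by apply: (measurable_comp_continuous continuous_rho).
by rewrite /brom /brom_amp /brom_phase; mtac.
Qed.

(** On the line Re z = 1 this substitutes [z ^ al], of
    modulus [rho u ^ al] and argument [al * atan u], for the Laplace variable:
    [z ^ (- b) * (z ^ al) ^ (- d) * exp (- s * (z ^ al) ^ ga)]. *)
Lemma Rintegral_brom_wpsi al ga b d t s u : 0 < al < 1 -> 0 < ga < 1 -> 0 < s ->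
  \int[mu]_(r in D) (brom al b t r u * wpsi ga d r s) =
  brom (al * ga) (b + al * d) t s u.
Proof.
move=> a01 g01 s0; have /andP[a0 a1] := a01.
pose m := rho u `^ al; pose th := al * atan u; pose w := b * atan u - t * u.
have m0 : 0 < m by rewrite powR_gt0 ?rho_gt0.
have /andP[at1 at2] := atan_itv u.
have p0 := pi_gt0 R.
have thI : - (pi / 2) < th < pi / 2 by rewrite /th; apply/andP; split; nra.
have c0 : 0 < cos th by exact: cos_gt0_pihalf.
transitivity (expR t * rho u `^ (- b) * lap ga d m th w s).
  rewrite /lap -(RintegralZl _ (@measurable_itv0y R)) ?integrable_lap//.
  apply: eq_Rintegral => r _; rewrite /brom /brom_amp /lap_kernel expRD.
  have -> : brom_phase al b t r u = - (m * sin th * r + w).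
    by rewrite /brom_phase /m /th /w; ring.
  rewrite cosN -/m -/th (_ : r * (m * cos th) = m * cos th * r); last by ring.
  by ring.
rewrite (lapE _ _ g01 m0 thI s0) /brom /brom_amp expRD.
have -> : brom_phase (al * ga) (b + al * d) t s u =
   - (s * (m `^ ga * sin (ga * th)) + (d * th + w)).
  rewrite /brom_phase /m /th /w -powRrM.
  by rewrite (_ : al * ga * atan u = ga * (al * atan u)); ring.
rewrite cosN /m -!powRrM (_ : al * ga * atan u = ga * th); last by rewrite /th; ring.
rewrite (_ : - (b + al * d) = - b + al * - d); last by ring.
by rewrite (powRD_gt0 _ _ (rho_gt0 u)); ring.
Qed.

End composition.

Unset Implicit Arguments.

Theorem theorem6 (R : realType) (alpha beta gamma delta : R)
    (halpha : 0 < alpha < 1) (hgamma : 0 < gamma < 1)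
    (hbeta : alpha <= beta) (hdelta : gamma <= delta)
    (t s : R) (ht : 0 < t) (hs : 0 < s) :
  (@lebesgue_measure R).-integrable `]0, +oo[
    (EFin \o (fun r : R => psi alpha (beta - alpha) t r *
                           psi gamma (delta - gamma) r s)) /\
  psi (alpha * gamma) (beta - alpha + alpha * (delta - gamma)) t s =
    \int[@lebesgue_measure R]_(r in `]0, +oo[)
      (psi alpha (beta - alpha) t r * psi gamma (delta - gamma) r s).
Proof.
set b := beta - alpha; set d := delta - gamma.
have /andP[a0 a1] := halpha; have /andP[g0 g1] := hgamma.
have ag : 0 < alpha * gamma < 1 by apply/andP; split; nra.
pose D : set R := `]0%R, +oo[%classic.
have Dgt0 r : D r -> 0 < r by rewrite /D/= in_itv/= andbT.
(* The exponent N makes the Bromwich integrand decay in u, and compensates the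
   growth r ^ (d - 1) of the other factor at infinity. *)
have [N N0 hN] := exists_decay_exponent b (Num.max 0 (d + 1)) a0.
have [N00 dN] : 0 <= N /\ d + 1 <= N by move: N0; rewrite ge_max => /andP.
have [K1 K10 h1] := phi_decay halpha N00 hN.
have [K2 K20 h2] := wpsi_weighted_bound hgamma hs N00 dN.
have [K3 K30 h3] := brom_amp_decay halpha N00 hN.
have e0 := expR_gt0 t.
have psiE r : D r -> psi alpha b t r * psi gamma d r s = phi alpha b t r * wpsi gamma d r s.
  by move=> /Dgt0 r0; rewrite psi_phi// psi_wpsi.
have mw : measurable_fun D (fun r => wpsi gamma d r s).
  by apply: measurable_continuous_D => r r0; exact: continuous_wpsi_r.
have ifw : (@lebesgue_measure R).-integrable D (EFin \o (fun r => phi alpha b t r * wpsi gamma d r s)).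
  apply: (@integrable_le_wt _ _ (expR t * K1 * K2)).
    apply: measurable_continuous_D => r r0; apply: continuousM.
      exact: der_continuous (is_derive_phi b t halpha r0).
    exact: continuous_wpsi_r.
  move=> r r0; rewrite normrM -[leRHS]mulrA.
  apply: (@le_trans _ _ (expR t * K1 * (r `^ (- N) * `|wpsi gamma d r s|))).
    by rewrite mulrA ler_wpM2r ?h1.
  by rewrite ler_wpM2l ?h2// mulr_ge0// ltW.
split.
  apply: eq_integrable ifw; first exact: measurable_itv0y.
  by move=> r /set_mem Dr /=; rewrite -psiE.
transitivity (\int[@lebesgue_measure R]_(r in D) (phi alpha b t r * wpsi gamma d r s));
  last by apply: eq_Rintegral => r /set_mem Dr; rewrite psiE.
rewrite psi_phi//.
(* Fubini needs measurability on the whole plane, hence the extension by 0. *)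
pose W := (fun r => wpsi gamma d r s) \_ D.
have WE r : 0 < r -> W r = wpsi gamma d r s.
  by move=> r0; rewrite /W patchE mem_set// /D/= in_itv/= r0.
pose F r u := brom alpha b t r u * W r.
have mF : measurable_fun setT (fun z : R * R => F z.1 z.2).
  apply: measurable_funM; first exact: measurable_brom2.
  apply: measurableT_comp => //.
  by apply/(measurable_restrictT _ (@measurable_itv0y R)).
have E1 : \int[lebesgue_measure]_(r in D) \int[lebesgue_measure]_(u in D) F r u =
    pi * \int[lebesgue_measure]_(r in D) (phi alpha b t r * wpsi gamma d r s).
  rewrite -(RintegralZl _ (@measurable_itv0y R) ifw); apply: eq_Rintegral => r /set_mem /Dgt0 r0.
  rewrite /F WE// (RintegralZr _ (@measurable_itv0y R) (integrable_brom b t halpha r0)).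
  by rewrite [RHS]mulrA /phi mulVKf// gt_eqF// pi_gt0.
have E2 : \int[lebesgue_measure]_(u in D) \int[lebesgue_measure]_(r in D) F r u =
    \int[lebesgue_measure]_(u in D) brom (alpha * gamma) (b + alpha * d) t s u.
  apply: eq_Rintegral => u _; rewrite -Rintegral_brom_wpsi//.
  by apply: eq_Rintegral => r /set_mem /Dgt0 r0; rewrite /F WE.
have H : \int[lebesgue_measure]_(r in D) \int[lebesgue_measure]_(u in D) F r u =
    \int[lebesgue_measure]_(u in D) \int[lebesgue_measure]_(r in D) F r u.
  apply: (Rintegral_fubini (g := fun r => expR t * K3 * K2 * wt r) (h := wt) mF).
  - exact: integrable_wtZ.
  - exact: integrable_wt.
  - by move=> r r0; rewrite !mulr_ge0// ltW// wt_gt0.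
  - by move=> u _; rewrite ltW// wt_gt0.
  - move=> r u r0 u0; rewrite /F WE// normrM.
    apply: (@le_trans _ _ (expR t * K3 * (r `^ (- N) * `|wpsi gamma d r s|) * wt u)).
      rewrite (mulrA _ (r `^ (- N))) (mulrAC _ _ (wt u)) ler_wpM2r//.
      by rewrite (le_trans (norm_brom _ _ _ _ _))// h3.
    rewrite ler_wpM2r ?(ltW (wt_gt0 _))// -[leRHS]mulrA ler_wpM2l ?h2//.
    by rewrite mulr_ge0// ltW.
have H2 := etrans (esym E2) (etrans (esym H) E1).
rewrite /phi H2; apply: mulKf.
exact: (lt0r_neq0 (pi_gt0 R)).
Qed.
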